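(* There exist real numbers $b_k$, $k=1,2,\dots$, which are the coefficients of a power series with $b_1=-\frac12$, $b_2=-\frac16$, $b_3=\frac1{24}$, and universal constants $c\in(0,1)$, $C_1,C_2>0$ such that for all $K\in\mathbb{N}$ and all $n,d\in\mathbb{N}$ with $1\le n\le cd$, writing $\alpha=n/d$, $$|\sqrt nS|\le|\sqrt nB|\le C_1\,2^ne^n\alpha^{-n}\frac{1}{\sqrt n}\exp\Big(\sum_{k=1}^Kb_kn\alpha^k+O_K(n\alpha^{K+1})\Big)\le C_2|\sqrt nS| .$$
   Context: $\mathbb{N}=\{1,2,\dots\}$. $|\sqrt nS|$ is the number of $x\in\mathbb{Z}^d$ with $\sum_{j=1}^dx_j^2=n$ and $|\sqrt nB|$ is the number of $x\in\mathbb{Z}^d$ with $\sum_{j=1}^dx_j^2\le n$. The symbol $O_K(n\alpha^{K+1})$ denotes a real quantity $E_K(n,d)$ (the same quantity in both inequalities) satisfying $|E_K(n,d)|\le C_K\,n\alpha^{K+1}$ with $C_K$ depending only on $K$. The constants $c,C_1,C_2$ and the numbers $b_k$ do not depend on $n,d,K$. *)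

(* Defs.v *)
From mathcomp Require Import all_boot all_order all_algebra.
From mathcomp Require Import finmap.
From mathcomp Require Import all_classical all_reals all_analysis.

Set Implicit Arguments.
Unset Strict Implicit.
Unset Printing Implicit Defensive.

Import Order.TTheory GRing.Theory Num.Theory.
Import numFieldNormedType.Exports.

Local Open Scope classical_set_scope.
Local Open Scope ring_scope.

Definition sphere_pts (n d : nat) : set 'rV[int]_d :=
  [set x | \sum_(j < d) x 0 j ^+ 2 = n%:Z].

Definition ball_pts (n d : nat) : set 'rV[int]_d :=
  [set x | \sum_(j < d) x 0 j ^+ 2 <= n%:Z].

Arguments sphere_pts : clear implicits.
Arguments ball_pts : clear implicits.

(* [fset_set] sends an infinite set to the empty one; the lemmas
   [finite_ball_pts] and [finite_sphere_pts] below exclude that case. *)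
Definition card_sphere (n d : nat) : nat := #|` fset_set (sphere_pts n d)|.

Definition card_ball (n d : nat) : nat := #|` fset_set (ball_pts n d)|.

Lemma finite_ball_pts (n d : nat) : finite_set (ball_pts n d).
Proof.
pose f (u : {ffun 'I_d -> 'I_(n + n).+1}) : 'rV[int]_d :=
  \row_j ((u j : nat)%:Z - n%:Z).
apply: (@sub_finite_set _ _ (f @` [set: {ffun 'I_d -> 'I_(n + n).+1}]));
  last exact/finite_image/finite_finset.
move=> x /= xn.
have xj j : `|x 0 j| <= n%:Z.
  have x2 : x 0 j ^+ 2 <= n%:Z.
    apply: le_trans xn; rewrite (bigD1 j) //= lerDl.
    by apply: sumr_ge0 => i _; exact: sqr_ge0.
  apply: le_trans x2; rewrite -[leRHS]real_normK ?num_real //.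
  have [->|x0] := eqVneq (x 0 j) 0; first by rewrite normr0.
  by rewrite expr2 ler_peMr // -gtz0_ge1 normr_gt0.
exists [ffun j => inord (absz (x 0 j + n%:Z))] => //.
apply/rowP => j; rewrite mxE ffunE.
have /ler_normlP[xl xr] := xj j.
have x0 : 0 <= x 0 j + n%:Z by rewrite -lerBlDr sub0r lerNl.
rewrite inordK; first by rewrite gez0_abs // addrK.
by rewrite ltnS -lez_nat gez0_abs // PoszD lerD2r.
Qed.

Lemma finite_sphere_pts (n d : nat) : finite_set (sphere_pts n d).
Proof.
by apply: sub_finite_set (finite_ball_pts n d) => x xn; rewrite /ball_pts /= xn.
Qed.

(* Positive radius of convergence; formally, every sequence would qualify.
   The value [b 0] does not matter. *)
Definition power_series_coeffs (R : realType) (b : nat -> R) : Prop :=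
  exists2 r : R, 0 < r & forall x : R, `|x| < r -> cvgn (pseries b x).

(* Main.v *)
Require Import Defs.
From mathcomp Require Import all_boot all_order all_algebra.
From mathcomp Require Import finmap.
From mathcomp Require Import all_classical all_reals all_analysis.
From mathcomp Require Import ring lra zify.

Import Order.TTheory GRing.Theory Num.Theory.
Import numFieldNormedType.Exports.

Local Open Scope ring_scope.

(** The number of points on the sphere is a coefficient, [X^n] of
    [theta ^ d] with [theta = 1 + 2 X + 2 X^4 + 2 X^9 + ...], and the theorem is
    the saddle point asymptotics of that coefficient, uniform in [n] and [d].

    Fix [q > 0] and give the coordinates independent weights proportional to
    [q ^ (x ^ 2)]; then [q^n / theta(q)^d] times the number of points is the
    probability that the squared norm is [n].  Coordinates with [`|x| >= 2] are
    rare and are conditioned upon: if [D] coordinates remain and the others have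
    squared norm [M], the conditional probability is that of a binomial variable
    with [D] trials taking the value [n - M].  Stirling's formula compares it
    with [1 / sqrt n], from above and from below, up to a correction
    proportional to [Y ^ 2 / n], where [Y = n - M - D p] is the deviation
    from the conditional mean ([binprob_bounds]).  Averaging over [(D, M)] only needs
    the second moment of [Y], which is explicit ([largesum_second_moment]) and
    small when [q] nearly solves the saddle point equation
    [d q theta'(q) = n theta(q)].  Hence the number of points is
    [q ^ - n theta(q) ^ d / sqrt n] up to constants ([card_sphere_saddle]).

    It remains to expand [q ^ - n theta(q) ^ d] in [alpha = n / d].  Writing
    [q = alpha s / 2], the saddle point equation becomes a fixed point equation
    for [s], whose iteration from [s = 1] takes place among polynomials in
    [alpha]; the coefficients stabilize and a weighted l1 norm stays bounded.
    The same holds for the polynomials built from [s] that approximate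
    [ln theta / alpha - ln s - 1], so that this quantity is the sum of a
    convergent power series, the one with coefficients [b_k] ([rate_approx]).
    Every [theta] is truncated at a level growing with the iteration, so that
    only polynomials are ever evaluated; the limit is replaced by a stage of
    the iteration that is late enough compared with [n].  The error term of the
    theorem is the tail of this power series multiplied by [n].

    Balls reduce to spheres: below radius [sqrt n] the sphere sizes at least
    double at each step, so that they sum up geometrically
    ([card_ball_le_sphere]). *)

(** * Sums over the coordinates of absolute value at least two *)

(** Sum over all ways to choose, among [d] coordinates, which ones have absolute
    value at least 2 (and less than [L]) and their values; [Phi] receives the
    number of remaining coordinates and the squared norm of the chosen ones.
    The recursion on [d] replaces multinomial coefficients, and the factor 2 is
    the choice of a sign. *)
Fixpoint largesum {V : nmodType} (L d : nat) (Phi : nat -> nat -> V) : V :=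
  if d is d'.+1 then
    largesum L d' (fun D M => Phi D.+1 M) +
    \sum_(2 <= k < L) largesum L d' (fun D M => Phi D (M + k ^ 2)%N) *+ 2
  else Phi 0%N 0%N.

Lemma eq_largesum {V : nmodType} L d (Phi Psi : nat -> nat -> V) :
  (forall D M, Phi D M = Psi D M) -> largesum L d Phi = largesum L d Psi.
Proof.
elim: d Phi Psi => [|d IH] Phi Psi e /=; first exact: e.
congr (_ + _); first by apply: IH => D M; exact: e.
by apply: eq_bigr => k _; congr (_ *+ 2); apply: IH => D M; exact: e.
Qed.

Lemma raddf_largesum {V W : nmodType} (f : {additive V -> W}) L d
    (Phi : nat -> nat -> V) :
  f (largesum L d Phi) = largesum L d (fun D M => f (Phi D M)).
Proof.
elim: d Phi => [//|d IH] Phi /=.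
rewrite raddfD IH raddf_sum; congr (_ + _).
by apply: eq_bigr => k _; rewrite raddfMn IH.
Qed.

Lemma largesumD {V : nmodType} L d (Phi Psi : nat -> nat -> V) :
  largesum L d (fun D M => Phi D M + Psi D M) =
  largesum L d Phi + largesum L d Psi.
Proof.
elim: d Phi Psi => [//|d IH] Phi Psi /=.
rewrite IH addrACA; congr (_ + _); rewrite -big_split /=.
by apply: eq_bigr => k _; rewrite IH mulrnDl.
Qed.

Lemma largesumZ {R : pzRingType} L d (c : R) (Phi : nat -> nat -> R) :
  largesum L d (fun D M => c * Phi D M) = c * largesum L d Phi.
Proof.
elim: d Phi => [//|d IH] Phi /=; rewrite IH mulrDr mulr_sumr.
by congr (_ + _); apply: eq_bigr => k _; rewrite IH mulrnAr.
Qed.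

(** The constraint [4 * (d - D) <= M] records that a large coordinate
    contributes at least 4 to the squared norm. *)
Lemma ler_largesum {R : numDomainType} L d (Phi Psi : nat -> nat -> R) :
  (forall D M, (D <= d)%N -> (4 * (d - D) <= M)%N -> Phi D M <= Psi D M) ->
  largesum L d Phi <= largesum L d Psi.
Proof.
elim: d Phi Psi => [|d IH] Phi Psi le /=; first exact: le.
apply: lerD; first by apply: IH => D M Dd dM; apply: le; lia.
rewrite !big_nat; apply: ler_sum => k /andP[k2 _]; rewrite lerMn2r /=.
apply: IH => D M Dd dM; apply: le; first by lia.
by rewrite subSn // mulnS addnC leq_add // (leq_trans _ (leq_mul k2 k2)).
Qed.

(** Theta polynomial at [q], in which a single quantity [a] stands for the three
    values -1, 0 and 1 of a coordinate. *)
Definition coord_gf {R : pzSemiRingType} (L : nat) (a q : R) : R :=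
  a + \sum_(2 <= k < L) q ^+ (k ^ 2) *+ 2.

(** Since the ring is arbitrary, this serves both for the total mass of the
    weights (real [q]) and for generating functions ([q] an indeterminate). *)
Lemma largesum_exp {R : comPzSemiRingType} L d (c a q : R) :
  largesum L d (fun D M => c * (a ^+ D * q ^+ M)) = c * coord_gf L a q ^+ d.
Proof.
elim: d c => [|d IH] c /=; first by rewrite !expr0 !mulr1.
rewrite exprS mulrA {2}/coord_gf mulrDr mulrDl; congr (_ + _).
  by rewrite -IH; apply: eq_largesum => D M; rewrite exprS !mulrA.
rewrite mulr_sumr mulr_suml; apply: eq_bigr => k _.
rewrite mulrnAr mulrnAl; congr (_ *+ 2).
rewrite -IH; apply: eq_largesum => D M.
by rewrite exprD -[RHS]mulrA [q ^+ _ * (_ * _)]mulrCA [q ^+ (k ^ 2) * _]mulrC.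
Qed.

(** Under the product weights, [M + D p] is a sum of [d] independent variables,
    equal to [p] on a small coordinate and to [k ^ 2] on a large one; [mu] and [v]
    are their mean and variance, so the centred second moment is bias squared
    plus [d] times the variance. *)
Lemma largesum_second_moment {R : fieldType} L d (w q p mu v a : R) :
  let Z := coord_gf L w q in
  w * p + \sum_(2 <= k < L) (q ^+ (k ^ 2) * (k ^ 2)%:R) *+ 2 = Z * mu ->
  w * p ^+ 2 + \sum_(2 <= k < L) (q ^+ (k ^ 2) * (k ^ 2)%:R ^+ 2) *+ 2 =
    Z * (v + mu ^+ 2) ->
  largesum L d (fun D M =>
    w ^+ D * q ^+ M * (a - M%:R - D%:R * p) ^+ 2) =
  Z ^+ d * ((a - d%:R * mu) ^+ 2 + d%:R * v).
Proof.
move=> Z m1 m2; elim: d a => [|d IH] a /=.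
  by rewrite !expr0 !mul0r !subr0 addr0 !mul1r.
pose A := a - d%:R * mu.
pose F y := Z ^+ d * ((A - y) ^+ 2 + d%:R * v).
have -> : largesum L d (fun D M =>
    w ^+ D.+1 * q ^+ M * (a - M%:R - D.+1%:R * p) ^+ 2) = w * F p.
  rewrite /F /A addrAC -IH -largesumZ.
  by apply: eq_largesum => D M; rewrite exprS -natr1; ring.
under eq_bigr => k _.
  have -> : largesum L d (fun D M => w ^+ D * q ^+ (M + k ^ 2) *
     (a - (M + k ^ 2)%:R - D%:R * p) ^+ 2) = q ^+ (k ^ 2) * F (k ^ 2)%:R.
    rewrite /F /A addrAC -IH -largesumZ.
    apply: eq_largesum => D M; rewrite exprD natrD; ring.
  have -> : (q ^+ (k ^ 2) * F (k ^ 2)%:R) *+ 2 =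
     (Z ^+ d * (A ^+ 2 + d%:R * v)) * (q ^+ (k ^ 2) *+ 2)
     - (2 * Z ^+ d * A) * ((q ^+ (k ^ 2) * (k ^ 2)%:R) *+ 2)
     + Z ^+ d * ((q ^+ (k ^ 2) * (k ^ 2)%:R ^+ 2) *+ 2).
    by rewrite /F; ring.
  over.
rewrite big_split sumrB /= -!mulr_sumr.
rewrite [Z ^+ d.+1]exprS {}/F {}/A; move: (Z ^+ d) => Zd; move: m1 m2.
rewrite /Z /coord_gf.
set S1 := \sum_(_ <= _ < _) _; set S0 := \sum_(_ <= _ < _) _.
set S2 := \sum_(_ <= _ < _) _ => m1 m2.
have -> : S1 = (w + S0) * mu - w * p by rewrite -m1 addrC addKr.
have -> : S2 = (w + S0) * (v + mu ^+ 2) - w * p ^+ 2 by rewrite -m2 addrC addKr.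
by rewrite -[d.+1%:R]natr1; ring.
Qed.

(** * Lattice points as coefficients of a power of the theta polynomial *)

Local Open Scope classical_set_scope.

Lemma card_fset_set_image (T : finType) (U : choiceType) (f : T -> U)
    (P : pred T) :
  injective f -> #|` fset_set (f @` [set` P])| = #|P|.
Proof.
move=> f_inj.
have -> : f @` [set` P] = [set` [fset f u | u in P]%fset].
  apply/seteqP; split => x /=.
    by case=> u Pu <-; apply/imfsetP; exists u.
  by case/imfsetP => u Pu ->; exists u.
by rewrite set_fsetK card_imfset //= cardE.
Qed.

(** Squared value [(i - m) ^ 2] of the coordinate coded by [i]; one of the two
    truncated differences vanishes. *)
Definition sqdist (m i : nat) : nat := ((i - m) + (m - i)) ^ 2.

Lemma sqdistE m i : (sqdist m i)%:Z = (i%:Z - m%:Z) ^+ 2.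
Proof.
rewrite /sqdist -mulnn PoszM expr2; case: (leqP m i) => [mi|/ltnW im].
  have -> : (i - m + (m - i))%N%:Z = i%:Z - m%:Z by lia.
  by [].
have -> : (i - m + (m - i))%N%:Z = - (i%:Z - m%:Z) by lia.
by rewrite mulrNN.
Qed.

(** Points of a ball of squared radius at most [m] have coordinates in [-m, m],
    so they can be counted over a finite function type. *)
Definition shift_vec m d (u : {ffun 'I_d -> 'I_(m + m).+1}) : 'rV[int]_d :=
  \row_j ((u j : nat)%:Z - m%:Z).

Lemma shift_vec_inj m d : injective (@shift_vec m d).
Proof.
move=> u v /rowP uv; apply/ffunP => j; apply/val_inj.
by have := uv j; rewrite !mxE => /addIr [].
Qed.

Lemma shift_vec_normsq m d u :
  \sum_(j < d) (shift_vec m d u) 0 j ^+ 2 = (\sum_(j < d) sqdist m (u j))%N%:Z.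
Proof.
rewrite -natz natr_sum; apply: eq_bigr => j _.
by rewrite mxE natz sqdistE.
Qed.

Lemma shift_vec_surj m d (x : 'rV[int]_d) :
  \sum_(j < d) x 0 j ^+ 2 <= m%:Z -> exists u, shift_vec m d u = x.
Proof.
move=> xm; have xj j : `|x 0 j| <= m%:Z.
  have : x 0 j ^+ 2 <= m%:Z.
    apply: le_trans xm; rewrite (bigD1 j) //= lerDl.
    by apply: sumr_ge0 => i _; exact: sqr_ge0.
  by nia.
exists [ffun j => inord (absz (x 0 j + m%:Z))].
by apply/rowP => j; rewrite mxE ffunE inordK; have := xj j; lia.
Qed.

Lemma card_sphere_ffun m n d : (n <= m)%N ->
  card_sphere n d =
  #|[pred u : {ffun 'I_d -> 'I_(m + m).+1} | \sum_j sqdist m (u j) == n]|.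
Proof.
move=> nm; rewrite -(card_fset_set_image _ _ _ _ (@shift_vec_inj m d)).
rewrite /card_sphere; congr (#|` fset_set _|); apply/seteqP; split => x /=.
  move=> xn; have [|u ux] := @shift_vec_surj m d x; first by rewrite xn; lia.
  exists u => //; move: xn; rewrite -ux /sphere_pts /= shift_vec_normsq inE.
  by case=> /eqP.
by case=> u /eqP un <-; rewrite /sphere_pts /= shift_vec_normsq un.
Qed.

Lemma card_ball_ffun m n d : (n <= m)%N ->
  card_ball n d =
  #|[pred u : {ffun 'I_d -> 'I_(m + m).+1} | \sum_j sqdist m (u j) <= n]%N|.
Proof.
move=> nm; rewrite -(card_fset_set_image _ _ _ _ (@shift_vec_inj m d)).
rewrite /card_ball; congr (#|` fset_set _|); apply/seteqP; split => x /=.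
  move=> xn; have [|u ux] := @shift_vec_surj m d x; first by apply: le_trans xn _; lia.
  by exists u => //; move: xn; rewrite -ux /ball_pts /= shift_vec_normsq inE.
by case=> u un <-; rewrite /ball_pts /= shift_vec_normsq.
Qed.

Lemma card_ball_sum n d :
  card_ball n d = (\sum_(0 <= m < n.+1) card_sphere m d)%N.
Proof.
rewrite (card_ball_ffun n) // -sum1_card /= big_mkcond /=.
rewrite big_nat; under [RHS]eq_bigr => m /andP[_ mn].
  rewrite (@card_sphere_ffun n m d) // -sum1_card big_mkcond /=.
  over.
rewrite -big_nat /= exchange_big /=; apply: eq_bigr => u _.
rewrite inE; set s := (\sum_(j < d) _)%N.
case: (leqP s n) => sn.
  rewrite (bigD1_seq s) ?mem_index_iota ?iota_uniq //= inE eqxx big1 // => i.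
  by rewrite inE eq_sym => /negPf ->.
rewrite big_nat big1 // => i /andP[_ ilt]; rewrite inE.
by case: eqP => // si; move: sn ilt; rewrite -si ltnS ltnNge => /negPf ->.
Qed.

Lemma sum_sqdist (V : nmodType) (F : nat -> V) m :
  \sum_(i < (m + m).+1) F (sqdist m i) =
  F 0%N + \sum_(1 <= k < m.+1) F (k ^ 2)%N *+ 2.
Proof.
rewrite -(big_mkord xpredT (F \o sqdist m)) /=.
rewrite (@big_cat_nat _ _ _ m) //=; [|by lia].
have -> : \sum_(0 <= i < m) F (sqdist m i) = \sum_(1 <= k < m.+1) F (k ^ 2)%N.
  rewrite big_nat_rev /= big_add1 /= !big_nat; apply: eq_bigr => i /andP[_ im].
  by rewrite /sqdist; congr (F (_ ^ 2)%N); lia.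
have -> : \sum_(m <= i < (m + m).+1) F (sqdist m i) =
    \sum_(0 <= k < m.+1) F (k ^ 2)%N.
  rewrite -{1}[m]add0n big_addn.
  have -> : ((m + m).+1 - m = m.+1)%N by lia.
  by apply: eq_bigr => i _; rewrite /sqdist; congr (F (_ ^ 2)%N); lia.
rewrite [X in _ + X]big_nat_recl //= exp0n // addrCA; congr (_ + _).
by rewrite !big_add1 /= -big_split.
Qed.

Lemma card_sphere_coef (R : comNzRingType) L n d : (1 < L)%N -> (n < L)%N ->
  (card_sphere n d)%:R = (coord_gf L (1 + 'X *+ 2) 'X ^+ d : {poly R})`_n.
Proof.
case: L => [|[|m]] // _; rewrite ltnS => nm.
have -> : coord_gf m.+2 (1 + 'X *+ 2) 'X =
    \sum_(i < (m.+1 + m.+1).+1) 'X^(sqdist m.+1 i) :> {poly R}.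
  rewrite (sum_sqdist _ (fun i => 'X^i)) expr0 /coord_gf -addrA; congr (_ + _).
  by rewrite [RHS]big_ltn.
rewrite -{2}[d]card_ord -prodr_const bigA_distr_bigA /= coef_sum.
rewrite (card_sphere_ffun _ _ _ nm) -sum1_card natr_sum big_mkcond /=.
apply: eq_bigr => u _.
by rewrite prodrXr coefXn inE eq_sym; case: ifP.
Qed.

Local Close Scope classical_set_scope.

(** * Taylor polynomials of the logarithm *)

(** Taylor polynomial of [ln (1 + t)] at [t = 0]. *)
Definition lnpoly (R : fieldType) (N : nat) : {poly R} :=
  \sum_(k < N) ((-1) ^+ k / k.+1%:R : R) *: 'X^(k.+1).

Lemma lnpoly_horner (R : realType) N (t : R) :
  (lnpoly R N).[t] = \sum_(k < N) (-1) ^+ k / k.+1%:R * t ^+ k.+1.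
Proof.
by rewrite horner_sum; apply: eq_bigr => k _; rewrite hornerZ hornerXn.
Qed.

Lemma deriv_lnpoly (R : realType) N (t : R) :
  (1 + t) * (lnpoly R N)^`().[t] = 1 - (- t) ^+ N.
Proof.
have -> : (lnpoly R N)^`().[t] = \sum_(k < N) (- t) ^+ k.
  rewrite /lnpoly raddf_sum /= horner_sum; apply: eq_bigr => k _.
  rewrite derivZ derivXn /= hornerZ hornerMn hornerXn mulrnAr -mulrnAl.
  by rewrite -[_ / _ *+ _]mulr_natr divfK ?pnatr_eq0 // [RHS]exprNn.
rewrite -[1 in RHS](expr1n _ N) subrXX opprK; congr (_ * _).
by apply: eq_bigr => k _; rewrite expr1n mul1r.
Qed.

Lemma is_derive_ln1D_sub (R : realType) (p : {poly R}) (t : R) : -1 < t ->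
  is_derive t 1 (fun u => ln (1 + u) - p.[u]) ((1 + t)^-1 - p^`().[t]).
Proof.
move=> t1; apply: is_deriveB.
have t0 : 0 < 1 + t by lra.
have dln : is_derive (1 + t) 1 (@ln R) (1 + t)^-1 by exact: is_derive1_ln.
have dt : is_derive t 1 (fun u => 1 + u) (0 + 1 : R) by apply: is_deriveD.
have := is_derive1_comp dln dt.
by rewrite add0r mulr1.
Qed.

(** The derivative of the remainder is exactly [(- u) ^ N / (1 + u)], so the mean
    value theorem gives both its size and its sign. *)
Lemma ln1D_lnpoly (R : realType) N (t : R) : -1 < t -> exists2 c : R,
  Num.min 0 t <= c <= Num.max 0 t &
  ln (1 + t) - (lnpoly R N).[t] = (- c) ^+ N / (1 + c) * t.
Proof.
move=> t1; set f := fun u => ln (1 + u) - (lnpoly R N).[u].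
set df := fun u => (1 + u)^-1 - (lnpoly R N)^`().[u].
have f0 : f 0 = 0.
  rewrite /f addr0 ln1 lnpoly_horner big1 ?subrr // => k _.
  by rewrite exprS mul0r mulr0.
have dfE (c : R) : -1 < c -> df c = (- c) ^+ N / (1 + c).
  move=> c1; rewrite /df; have c0 : 1 + c != 0 by lra.
  by apply: (mulfI c0); rewrite mulrBr deriv_lnpoly mulfV // [RHS]mulrC divfK //; ring.
have key (a b : R) : -1 < a -> a <= b ->
    exists2 c : R, c \in `[a, b] & f b - f a = df c * (b - a).
  move=> a1 ab; have der x : a <= x -> is_derive x 1 f (df x).
    by move=> ax; apply: is_derive_ln1D_sub; lra.
  apply: MVT_segment => // [x|].
    by rewrite in_itv /= => /andP[/ltW ax _]; exact: der.
  apply: derivable_within_continuous => x; rewrite in_itv /= => /andP[ax _].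
  by have [] := der _ ax.
have [t0|/ltW t0] := leP 0 t.
  have [||c] := key 0 t; [lra..|]; rewrite in_itv /= => cI.
  rewrite f0 !subr0 => e; exists c => //.
  by rewrite -[LHS]/(f t) e dfE //; lra.
have [||c] := key t 0; [lra..|]; rewrite in_itv /= => cI.
rewrite f0 !sub0r => e; exists c => //.
by rewrite -[LHS]/(f t) -[LHS]opprK e dfE ?mulrN ?opprK //; lra.
Qed.

Lemma ln1D_lnpoly_le (R : realType) N (t : R) : `|t| <= 1 / 2 ->
  `|ln (1 + t) - (lnpoly R N).[t]| <= 2 * `|t| ^+ N.+1.
Proof.
move=> /[dup] /ler_normlP[t1 t2] tle.
have [|c cI ->] := @ln1D_lnpoly R N t; first lra.
have ct : `|c| <= `|t|.
  move: cI; have [t0|t0] := leP 0 t => /andP[? ?].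
    by rewrite !ger0_norm //; lra.
  by rewrite ler0_norm ?ltr0_norm //; lra.
have := le_trans ct tle => /ler_normlP[? ?].
rewrite !normrM normfV normrX normrN [ `|1 + c|]ger0_norm; last lra.
rewrite exprSr mulrA ler_wpM2r // mulrC ler_pM ?exprn_ge0 ?invr_ge0 //; last 1 first.
- by rewrite lerXn2r ?nnegrE.
- lra.
- by rewrite -[2]invrK lef_pV2 ?posrE; lra.
Qed.

Lemma ln1D_ge_quadratic (R : realType) (x : R) : 0 <= x -> x - x ^+ 2 / 2 <= ln (1 + x).
Proof.
move=> x0; have [|c] := @ln1D_lnpoly R 2 x; first lra.
rewrite minEle maxEle x0 lnpoly_horner !big_ord_recr big_ord0 /= => cI e.
have : 0 <= (- c) ^+ 2 / (1 + c) * x.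
  by rewrite mulr_ge0 // divr_ge0 ?sqr_ge0 //; lra.
by rewrite -e; lra.
Qed.

Lemma ln1D_le_cubic (R : realType) (x : R) : 0 <= x ->
  ln (1 + x) <= x - x ^+ 2 / 2 + x ^+ 3 / 3.
Proof.
move=> x0; have [|c] := @ln1D_lnpoly R 3 x; first lra.
rewrite minEle maxEle x0 lnpoly_horner !big_ord_recr big_ord0 /= => cI e.
have : 0 <= c ^+ 3 / (1 + c) * x.
  by rewrite mulr_ge0 // divr_ge0 ?exprn_ge0 //; lra.
have -> : c ^+ 3 / (1 + c) * x = - ((- c) ^+ 3 / (1 + c) * x) by ring.
by rewrite -e; lra.
Qed.

(** * Stirling bounds for factorials *)

Lemma expR_half_le2 (R : realType) : expR (1 / 2) <= 2 :> R.
Proof.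
have := expR_ge1Dx (- (1 / 2) : R); rewrite expRN.
have e0 := expR_gt0 (1 / 2 : R); move: (expR _) e0 => e e0 h.
by have := ler_wpM2l (ltW e0) h; rewrite mulfV ?gt_eqF //; lra.
Qed.

Lemma expR_half_ln (R : realType) (x : R) : 0 < x -> expR (ln x / 2) = Num.sqrt x.
Proof.
move=> x0; rewrite -[LHS]ger0_norm ?expR_ge0 // -sqrtr_sqr -expRM_natl.
by congr Num.sqrt; rewrite mulrC divfK // lnK.
Qed.

(** The defect [ln N! - (N + 1/2) ln N + N] changes by
    [1 - (N + 1/2) ln (1 + 1/N)] from [N] to [N + 1]; this is at most
    [1 / (4 N^2)] in absolute value, hence at most half of
    [1/N - 1/(N+1)], which telescopes. *)
Lemma ln_fact_stirling (R : realType) N : (0 < N)%N ->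
  `|ln N`!%:R - (N%:R + 1 / 2) * ln N%:R + N%:R - 1| <= (1 - N%:R^-1) / 2 :> R.
Proof.
case: N => // N _; elim: N => [|N IH].
  have -> : 1`! = 1%N by [].
  by rewrite ln1 mulr0 subr0 add0r subrr normr0 invr1 subrr mul0r.
set x : R := N.+1%:R in IH *; have x1 : 1 <= x by rewrite ler1n.
have -> : N.+2%:R = x + 1 :> R by rewrite natr1.
have x0 : 0 < x by lra.
have xV : 0 < x^-1 by rewrite invr_gt0.
have xN0 : x != 0 by lra.
have -> : ln N.+2`!%:R = ln (x + 1) + ln N.+1`!%:R :> R.
  by rewrite factS natrM lnM ?posrE ?ltr0n ?fact_gt0 // natr1.
have -> : ln (x + 1) = ln x + ln (1 + x^-1).
  by rewrite -lnM ?posrE ?addr_gt0 // mulrDr mulr1 mulfV.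
have l1 := ln1D_ge_quadratic _ _ (ltW xV).
have l2 := ln1D_le_cubic _ _ (ltW xV).
set l := ln (1 + _) in l1 l2 *.
have xx : x * x^-1 = 1 by rewrite mulfV.
have x1V : (x + 1) * (x + 1)^-1 = 1 by rewrite mulfV //; lra.
set y := x^-1 in l1 l2 xV xx IH *.
set z := (x + 1)^-1 in x1V *.
have step : `|(x + 1 / 2) * l - 1| <= (y - z) / 2.
  have yz : y ^+ 2 / 4 <= (y - z) / 2.
    have -> : z = y / (1 + y).
      apply: (mulfI (_ : x + 1 != 0)); first by lra.
      rewrite x1V; have -> : x + 1 = x * (1 + y) by rewrite mulrDr mulr1 xx.
      rewrite -xx; field; lra.
    have -> : y - y / (1 + y) = y ^+ 2 / (1 + y) by field; lra.
    rewrite -mulrA -invfM ler_pM2l ?exprn_gt0 // lef_pV2 ?posrE; nra.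
  apply: le_trans yz.
  (* The terms of order [1 / N] cancel, which leaves an error of order [1 / N ^ 2]. *)
  have e1 : (x + 1 / 2) * (y - y ^+ 2 / 2) = 1 - y ^+ 2 / 4.
    transitivity (x * y * (1 - y / 2) + y / 2 - y ^+ 2 / 4); first by field.
    by rewrite xx; field.
  have e2 : (x + 1 / 2) * (y - y ^+ 2 / 2 + y ^+ 3 / 3) =
      1 + y ^+ 2 / 12 + y ^+ 3 / 6.
    transitivity (x * y * (1 - y / 2 + y ^+ 2 / 3) + y / 2 - y ^+ 2 / 4
      + y ^+ 3 / 6); first by field.
    by rewrite xx; field.
  have x2 : 0 <= x + 1 / 2 by lra.
  have := ler_wpM2l x2 l1; have := ler_wpM2l x2 l2; rewrite e1 e2 => h1 h2.
  have y3 : y ^+ 3 <= y ^+ 2 by rewrite exprS ler_piMl ?sqr_ge0 //; nra.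
  by rewrite ler_norml; lra.
move: IH step; rewrite !ler_norml => /andP[h1 h2] /andP[h3 h4].
by apply/andP; split; lra.
Qed.

(** With [N + 1] under the root, the bounds hold for [N = 0] as well. *)
Definition stirling (R : realType) (N : nat) : R :=
  Num.sqrt N.+1%:R * N%:R ^+ N * expR (- N%:R).

Lemma fact_stirling (R : realType) N :
  stirling R N <= N`!%:R <= 8 * stirling R N.
Proof.
case: N => [|N].
  by rewrite /stirling sqrtr1 expr0 oppr0 expR0 fact0 !mulr1; lra.
have := ln_fact_stirling R N.+1 isT.
set x : R := N.+1%:R; have x1 : 1 <= x by rewrite ler1n.
have x0 : 0 < x by lra.
have xV : 0 < x^-1 by rewrite invr_gt0.
set a := (ln _ - _ + _) => aP.
have /andP[a1 a2] : 1 / 2 <= a <= 3 / 2.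
  move: (x^-1) xV a aP => y y0 a; rewrite ler_norml => /andP[? ?]; lra.
have -> : N.+1`!%:R = expR a * (Num.sqrt x * x ^+ N.+1 * expR (- x)) :> R.
  rewrite -expR_half_ln // -[x ^+ _](@lnK R) ?posrE ?exprn_gt0 //.
  rewrite lnXn // -!expRD -[LHS](@lnK R) ?posrE ?ltr0n ?fact_gt0 //.
  by congr expR; rewrite /a -mulr_natl -/x; field.
set P := Num.sqrt x * _ * _.
have P0 : 0 <= x ^+ N.+1 * expR (- x).
  by rewrite mulr_ge0 ?expR_ge0 // exprn_ge0 // ltW.
have -> : stirling R N.+1 = Num.sqrt (x + 1) * (x ^+ N.+1 * expR (- x)).
  by rewrite /stirling mulrA -[N.+2%:R]natr1.
rewrite /P -[Num.sqrt x * _ * _]mulrA !mulrA -![_ * x ^+ _ * _]mulrA.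
rewrite !ler_wpM2r //.
  have ea : expR a <= 2 ^+ 3.
    apply: le_trans (lerXn2r _ _ _ (expR_half_le2 R)); rewrite ?nnegrE ?expR_ge0 //.
    by rewrite -expRM_natl ler_expR; lra.
  apply: ler_pM; rewrite ?expR_ge0 ?sqrtr_ge0 //; first by lra.
  by rewrite ler_sqrt; lra.
have ea : Num.sqrt 2 <= expR a.
  rewrite -(@ler_pXn2r _ 2) ?nnegrE ?sqrtr_ge0 ?expR_ge0 // sqr_sqrtr //.
  rewrite -expRM_natl; apply: le_trans (expR_ge1Dx _) _.
  by rewrite ler_expR; lra.
apply: le_trans (ler_wpM2r (sqrtr_ge0 x) ea).
by rewrite -sqrtrM // ler_sqrt; nra.
Qed.

(** * Binomial probabilities *)

(** The function [x ^ N * exp (- x)] is maximal at [x = N].  Used for both factors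
    of a binomial probability, this says that relative entropy is nonnegative. *)
Lemma exprn_le_expR (R : realType) N (x : R) : 0 <= x ->
  x ^+ N <= N%:R ^+ N * expR (x - N%:R).
Proof.
case: N => [|N] x0; first by rewrite !expr0 mul1r subr0 -expR0 ler_expR.
set y : R := N.+1%:R; have y0 : 0 < y by rewrite ltr0n.
have -> : x - y = y * (x / y - 1) by rewrite mulrBr mulr1 mulrC divfK ?gt_eqF.
rewrite expRM_natl -exprMn; apply: lerXn2r; rewrite ?nnegrE //.
  by rewrite mulr_ge0 ?expR_ge0 // ltW.
have := expR_ge1Dx (x / y - 1); rewrite addrC subrK => h.
by rewrite mulrC -ler_pdivrMr.
Qed.

(** Converse of [exprn_le_expR]; used for both factors of a binomial probability,
    it bounds the relative entropy by a chi-square distance. *)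
Lemma exprn_ge_expR (R : realType) N (x : R) : 0 < x ->
  N%:R ^+ N * expR (N%:R - N%:R ^+ 2 / x) <= x ^+ N.
Proof.
case: N => [|N] x0; first by rewrite !expr0 mul1r expr0n mul0r subr0 expR0.
set y : R := N.+1%:R; have y0 : 0 < y by rewrite ltr0n.
have -> : y - y ^+ 2 / x = y * (- (y / x - 1)) by field; rewrite gt_eqF.
rewrite expRM_natl -exprMn; apply: lerXn2r; rewrite ?nnegrE //; [|exact: ltW|].
  by rewrite mulr_ge0 ?expR_ge0 // ltW.
have := expR_ge1Dx (y / x - 1); rewrite addrC subrK => h.
by rewrite expRN ler_pdivrMr ?expR_gt0 // mulrC -ler_pdivrMr.
Qed.

Lemma bin_fact_real (R : realType) (D N : nat) : (N <= D)%N ->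
  'C(D, N)%:R * (N`!%:R * (D - N)`!%:R) = D`!%:R :> R.
Proof. by move=> ND; rewrite -!natrM bin_fact. Qed.

(** Factor of [stirling] that remains after the exponentials cancel. *)
Definition selfpow (R : realType) (N : nat) : R := N%:R ^+ N.

Lemma selfpow_gt0 (R : realType) N : 0 < selfpow R N.
Proof. by case: N => [|N]; rewrite ?/selfpow ?expr0 // exprn_gt0 // ltr0n. Qed.

Lemma expR_split (R : realType) (D N : nat) : (N <= D)%N ->
  expR (- D%:R) = expR (- N%:R) * expR (- (D - N)%:R) :> R.
Proof. by move=> ND; rewrite -expRD natrB //; congr expR; ring. Qed.

(** The hypothesis [2 * N <= D] makes the factor
    [sqrt ((D + 1) / (D - N + 1))] of Stirling's formula at most [3 / 2]. *)
Lemma bin_stirling_le (R : realType) (D N : nat) : (2 * N <= D)%N ->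
  'C(D, N)%:R * (selfpow R N * selfpow R (D - N)) * Num.sqrt N.+1%:R
  <= 12 * selfpow R D.
Proof.
move=> ND; have ND' : (N <= D)%N by lia.
have /andP[lN _] := fact_stirling R N.
have /andP[lM _] := fact_stirling R (D - N).
have /andP[_ uD] := fact_stirling R D.
have := bin_fact_real R D N ND'.
set C : R := 'C(D, N)%:R => e.
have C0 : 0 <= C by [].
have s0 K : 0 <= stirling R K.
  by rewrite /stirling !mulr_ge0 ?sqrtr_ge0 ?expR_ge0 // exprn_ge0.
have h : C * (stirling R N * stirling R (D - N)) <= 8 * stirling R D.
  apply: le_trans uD; rewrite -e; apply: ler_wpM2l => //; exact: ler_pM.
move: h; rewrite /stirling (expR_split R D N ND').
have eN := expR_gt0 (- N%:R : R); have eM := expR_gt0 (- (D - N)%:R : R).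
rewrite -/(selfpow R N) -/(selfpow R (D - N)) -/(selfpow R D).
move: (expR (- N%:R)) (expR (- (D - N)%:R)) eN eM => a b a0 b0.
have sM : 0 < Num.sqrt (D - N).+1%:R :> R by rewrite sqrtr_gt0.
have sD : Num.sqrt D.+1%:R <= 3 / 2 * Num.sqrt (D - N).+1%:R :> R.
  rewrite -(@ler_pXn2r _ 2) ?nnegrE ?sqrtr_ge0 ?mulr_ge0 // exprMn !sqr_sqrtr //.
  have : (D.+1 <= 2 * (D - N).+1)%N by lia.
  rewrite -(@ler_nat R) natrM; have : 0 <= (D - N).+1%:R :> R by [].
  lra.
move: (Num.sqrt (D - N).+1%:R) (Num.sqrt N.+1%:R) (Num.sqrt D.+1%:R) sM sD => u v w u0 wu.
have := selfpow_gt0 R D; have := selfpow_gt0 R N; have := selfpow_gt0 R (D - N).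
move: (selfpow R N) (selfpow R (D - N)) (selfpow R D) => P Q S Q0 P0 S0 h.
have abu : 0 < a * b * u by rewrite !mulr_gt0.
rewrite -(ler_pM2l abu).
apply: (@le_trans _ _ (8 * (w * S * (a * b)))).
  by apply: le_trans h; rewrite le_eqVlt; apply/orP; left; apply/eqP; ring.
have -> : 8 * (w * S * (a * b)) = a * b * S * 8 * w by ring.
have -> : a * b * u * (12 * S) = a * b * S * 8 * (3 / 2 * u) by field.
by rewrite ler_wpM2l // !mulr_ge0 // ltW.
Qed.

Lemma bin_stirling_ge (R : realType) (D N : nat) : (N <= D)%N ->
  selfpow R D <=
  64 * ('C(D, N)%:R * (selfpow R N * selfpow R (D - N)) * Num.sqrt N.+1%:R).
Proof.
move=> ND'.
have /andP[_ uN] := fact_stirling R N.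
have /andP[_ uM] := fact_stirling R (D - N).
have /andP[lD _] := fact_stirling R D.
have := bin_fact_real R D N ND'.
set C : R := 'C(D, N)%:R => e.
have C0 : 0 <= C by [].
have h : stirling R D <= C * (8 * stirling R N * (8 * stirling R (D - N))).
  apply: le_trans lD _; rewrite -e; apply: ler_wpM2l => //; exact: ler_pM.
move: h; rewrite /stirling (expR_split R D N ND').
have eN := expR_gt0 (- N%:R : R); have eM := expR_gt0 (- (D - N)%:R : R).
rewrite -/(selfpow R N) -/(selfpow R (D - N)) -/(selfpow R D).
move: (expR (- N%:R)) (expR (- (D - N)%:R)) eN eM => a b a0 b0.
have sM : 0 < Num.sqrt (D - N).+1%:R :> R by rewrite sqrtr_gt0.
have sD : Num.sqrt (D - N).+1%:R <= Num.sqrt D.+1%:R :> R.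
  by rewrite ler_wsqrtr // ler_nat; lia.
move: (Num.sqrt (D - N).+1%:R) (Num.sqrt N.+1%:R) (Num.sqrt D.+1%:R) sM sD => u v w u0 wu.
have := selfpow_gt0 R D; have := selfpow_gt0 R N; have := selfpow_gt0 R (D - N).
move: (selfpow R N) (selfpow R (D - N)) (selfpow R D) => P Q S Q0 P0 S0 h.
have abu : 0 < a * b * u by rewrite !mulr_gt0.
rewrite -(ler_pM2l abu).
apply: (@le_trans _ _ (w * S * (a * b))).
  have -> : a * b * u * S = a * b * S * u by ring.
  have -> : w * S * (a * b) = a * b * S * w by ring.
  by rewrite ler_wpM2l // !mulr_ge0 // ltW.
by apply: le_trans h _; rewrite le_eqVlt; apply/orP; left; apply/eqP; ring.
Qed.

Definition binprob {R : pzRingType} (D N : nat) (p : R) : R :=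
  'C(D, N)%:R * (p ^+ N * (1 - p) ^+ (D - N)).

Lemma binprob_le (R : realType) (D N : nat) (p : R) : 0 <= p <= 1 ->
  (2 * N <= D)%N ->
  binprob D N p * Num.sqrt N.+1%:R <= 12.
Proof.
rewrite /binprob.
move=> /andP[p0 p1] ND; have ND' : (N <= D)%N by lia.
have q0 : 0 <= 1 - p by lra.
have D0 : 0 <= D%:R :> R by [].
have x := exprn_le_expR R N (D%:R * p) (mulr_ge0 D0 p0).
have y := exprn_le_expR R (D - N) (D%:R * (1 - p)) (mulr_ge0 D0 q0).
have xy : selfpow R D * (p ^+ N * (1 - p) ^+ (D - N)) <=
    selfpow R N * selfpow R (D - N).
  have -> : selfpow R D * (p ^+ N * (1 - p) ^+ (D - N)) =
      (D%:R * p) ^+ N * (D%:R * (1 - p)) ^+ (D - N).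
    have eD : selfpow R D = D%:R ^+ N * D%:R ^+ (D - N).
      by rewrite -exprD subnKC.
    by rewrite eD !exprMn; ring.
  have -> : selfpow R N * selfpow R (D - N) =
    (selfpow R N * expR (D%:R * p - N%:R)) *
    (selfpow R (D - N) * expR (D%:R * (1 - p) - (D - N)%:R)).
    rewrite mulrACA -expRD natrB //.
    have -> : D%:R * p - N%:R + (D%:R * (1 - p) - (D%:R - N%:R)) = 0 :> R by ring.
    by rewrite expR0 mulr1.
  by apply: ler_pM; rewrite // exprn_ge0 // mulr_ge0.
have h := bin_stirling_le R D N ND.
have sD := selfpow_gt0 R D.
rewrite -(ler_pM2r sD); apply: le_trans h.
have Cs : 0 <= 'C(D, N)%:R * Num.sqrt N.+1%:R :> R by rewrite mulr_ge0 ?sqrtr_ge0.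
by apply: le_trans (le_trans (ler_wpM2r Cs xy) _); rewrite le_eqVlt;
  apply/orP; left; apply/eqP; ring.
Qed.

Lemma binprob_ge (R : realType) (D N : nat) (p : R) : 0 < p < 1 ->
  (0 < D)%N -> (N <= D)%N ->
  expR (- ((N%:R - D%:R * p) ^+ 2 / (D%:R * p * (1 - p)))) <=
  64 * (binprob D N p * Num.sqrt N.+1%:R).
Proof.
rewrite /binprob.
move=> /andP[p0 p1] D0 ND'.
have q0 : 0 < 1 - p by lra.
have {}D0 : 0 < D%:R :> R by rewrite ltr0n.
have x := exprn_ge_expR R N (D%:R * p) (mulr_gt0 D0 p0).
have y := exprn_ge_expR R (D - N) (D%:R * (1 - p)) (mulr_gt0 D0 q0).
set e := expR _.
have xy : selfpow R N * selfpow R (D - N) * e <=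
    selfpow R D * (p ^+ N * (1 - p) ^+ (D - N)).
  have -> : selfpow R D * (p ^+ N * (1 - p) ^+ (D - N)) =
      (D%:R * p) ^+ N * (D%:R * (1 - p)) ^+ (D - N).
    have eD : selfpow R D = D%:R ^+ N * D%:R ^+ (D - N).
      by rewrite -exprD subnKC.
    by rewrite eD !exprMn; ring.
  have -> : selfpow R N * selfpow R (D - N) * e =
    (selfpow R N * expR (N%:R - N%:R ^+ 2 / (D%:R * p))) *
    (selfpow R (D - N) *
     expR ((D - N)%:R - (D - N)%:R ^+ 2 / (D%:R * (1 - p)))).
    rewrite [RHS]mulrACA -expRD natrB //; congr (_ * expR _).
    by field; rewrite !gt_eqF.
  apply: ler_pM => //; rewrite mulr_ge0 ?expR_ge0 //; exact/ltW/selfpow_gt0.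
have h := bin_stirling_ge R D N ND'.
have sN : 0 < selfpow R N * selfpow R (D - N) by rewrite mulr_gt0 ?selfpow_gt0.
rewrite -(ler_pM2l sN); apply: le_trans xy _.
have t0 : 0 <= p ^+ N * (1 - p) ^+ (D - N).
  by rewrite mulr_ge0 // exprn_ge0 // ltW.
have := ler_wpM2r t0 h.
set t := p ^+ N * _; set S := selfpow R N * _; set s := Num.sqrt _.
by move=> h'; apply: le_trans h' _; rewrite le_eqVlt; apply/orP; left; apply/eqP; ring.
Qed.

(** * Conditioning on the large coordinates *)

(** Given the large coordinates, the other ones are 0, 1 or -1, and exactly
    [n - M] of them are nonzero. *)
Lemma card_sphere_largesum (R : comNzRingType) L n d :
  (1 < L)%N -> (n < L)%N ->
  (card_sphere n d)%:R = largesum L d (fun D M =>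
    if (M <= n)%N then ('C(D, n - M) * 2 ^ (n - M))%:R else 0) :> R.
Proof.
move=> L1 nL; rewrite (card_sphere_coef _ _ _ _ L1 nL).
rewrite -[_ ^+ d]mul1r -largesum_exp -/(coefp n _) raddf_largesum.
apply: eq_largesum => D M; rewrite mul1r /= coefMXn ltnNge.
case: (leqP M n) => //= Mn; rewrite exprDn coef_sum.
under eq_bigr => i _ do rewrite expr1n mul1r -mulr_natr exprMn_n
  -mulr_natr -mulrA -natrM -polyC_natr coefMC coefXn.
have [ND|DN] := leqP (n - M) D.
  rewrite (bigD1 (inord (n - M))) //= big1 ?addr0.
    by rewrite inordK // eqxx mul1r mulnC.
  move=> i /negP ine; rewrite (_ : _ == _ = false) ?mul0r //.
  by apply/negP => /eqP e; apply: ine; apply/eqP/val_inj; rewrite /= inordK.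
rewrite bin_small // mul0n big1 // => i _.
by rewrite (_ : _ == _ = false) ?mul0r //; have := ltn_ord i; lia.
Qed.

(** Already true for each choice of the large coordinates, where it compares
    consecutive terms of a binomial expansion well below the middle one. *)
Lemma card_sphere_double n d : (4 * n.+1 <= d)%N ->
  (2 * card_sphere n d <= card_sphere n.+1 d)%N.
Proof.
(* Casting into an ordered ring gives access to the monotonicity of [largesum]. *)
move=> nd; suff le_nat (R : numDomainType) :
    (2 * card_sphere n d)%:R <= (card_sphere n.+1 d)%:R :> R.
  by rewrite -(ler_nat int) le_nat.
rewrite natrM.
rewrite !(@card_sphere_largesum _ n.+3) //; last by lia.
rewrite -largesumZ.
apply: ler_largesum => D M Dd dM.
case: (leqP M n) => Mn; last by rewrite mulr0; case: ifP.
rewrite (leq_trans Mn) // -natrM ler_nat subSn // expnS.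
have [N eN] : {N | N = n - M}%N by exists (n - M)%N.
rewrite -eN; have ND : (2 * N + 1 <= D)%N by lia.
have := mul_bin_left D N; nia.
Qed.

Lemma card_ball_le_sphere n d : (4 * n <= d)%N ->
  (card_ball n d <= 2 * card_sphere n d)%N.
Proof.
elim: n => [|n IH] nd; rewrite card_ball_sum; first by rewrite big_nat1; lia.
rewrite big_nat_recr //= -card_ball_sum.
have := IH (leq_trans _ nd); have := card_sphere_double n d nd; lia.
Qed.

Lemma card_sphere_le_ball n d : (card_sphere n d <= card_ball n d)%N.
Proof. by rewrite card_ball_sum big_nat_recr //= leq_addl. Qed.

Lemma binprob_ge0 (R : realType) D N (p : R) : 0 <= p <= 1 -> 0 <= binprob D N p.
Proof.
by move=> /andP[p0 p1]; rewrite /binprob !mulr_ge0 ?exprn_ge0 ?subr_ge0.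
Qed.

(** Tilting by [q] turns the number of choices of the small coordinates into a
    binomial probability with parameter [2 q / (1 + 2 q)]. *)
Lemma binprob_tilt (R : realType) D N (q : R) : 0 < q ->
  (1 + 2 * q) ^+ D * binprob D N (2 * q / (1 + 2 * q)) =
  ('C(D, N) * 2 ^ N)%:R * q ^+ N.
Proof.
move=> q0; rewrite /binprob; have [ND|DN] := leqP N D; last first.
  by rewrite bin_small // !mul0r mulr0.
have w0 : 1 + 2 * q != 0 by lra.
have -> : 1 - 2 * q / (1 + 2 * q) = (1 + 2 * q)^-1 by field.
rewrite -{1}(subnKC ND) exprD exprMn !exprVn exprMn natrM natrX.
by field; rewrite !expf_neq0.
Qed.

(** Numerical consequences of [q] being close to [n / (2 d)], stated for
    [x = n], [y = d], [j] the number of large coordinates and [m] their squared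
    norm. *)
Lemma tilt_bounds (R : realType) (x y j m q : R) :
  let p := 2 * q / (1 + 2 * q) in
  1 <= x -> 100 * x <= y -> 7 * x <= 16 * (y * q) <= 9 * x ->
  0 <= j -> 4 * j <= m ->
  [/\ 0 < q, 0 < p, p <= 1 / 50, 8 / 10 * x <= y * p & 0 <= j * p <= m / 100].
Proof.
move=> p x1 xy /andP[q1 q2] j0 jm.
have y0 : 0 < y by lra.
have q0 : 0 < q by rewrite -(pmulr_rgt0 _ y0); lra.
have qs : q <= 9 / 1600 by rewrite -(ler_pM2l y0); lra.
have w0 : 0 < 1 + 2 * q by lra.
have p0 : 0 < p by rewrite divr_gt0 // mulr_gt0.
have p1 : p <= 1 / 50 by rewrite ler_pdivrMr //; lra.
have p2 : 19 / 10 * q <= p.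
  rewrite ler_pdivlMr // -subr_ge0.
  have -> : 2 * q - 19 / 10 * q * (1 + 2 * q) = q * (1 / 10 - 19 / 5 * q) by field.
  by rewrite mulr_ge0; lra.
move: (p) p0 p1 p2 => {}p p0 p1 p2; split => //.
  by have := ler_wpM2l (ltW y0) p2; lra.
apply/andP; split; first by rewrite mulr_ge0 // ltW.
by have := ler_wpM2l j0 p1; lra.
Qed.

(** The two bounds are designed to be averaged over [(D, M)] with the help of the
    second moment of [Y] alone.  When [M] is not small compared with [n], the
    probability may be of order 1 or 0 instead of [1 / sqrt n], but then
    [Y ^ 2 / n] is at least of order [n] and absorbs the discrepancy. *)
Lemma binprob_bounds (R : realType) n d D M (q : R) :
  let p := 2 * q / (1 + 2 * q) in
  let Y := n%:R - M%:R - D%:R * p in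
  let B := if (M <= n)%N then binprob D (n - M) p else 0 in
  (0 < n)%N -> (100 * n <= d)%N -> 7 * n%:R <= 16 * (d%:R * q) <= 9 * n%:R ->
  (D <= d)%N -> (4 * (d - D) <= M)%N ->
  B * Num.sqrt n%:R <= 18 * (1 + 16 / n%:R * Y ^+ 2) /\
  1 - 16 / n%:R * Y ^+ 2 <= 96 * (B * Num.sqrt n%:R).
Proof.
move=> p Y B n0 nd qd Dd dM.
have D2 : (M <= n)%N -> (2 * (n - M) <= D)%N by lia.
have D0 : (M <= n)%N -> (0 < D)%N by lia.
have ND : (M <= n)%N -> (n - M <= D)%N by lia.
have n1 : 1 <= n%:R :> R by rewrite ler1n.
have d100 : 100 * n%:R <= d%:R :> R by rewrite -natrM ler_nat.
have J0 : 0 <= (d - D)%:R :> R by [].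
have JM : 4 * (d - D)%:R <= M%:R :> R by rewrite -natrM ler_nat.
have [q0 p0 p1 dp /andP[Jp0 Jp]] := tilt_bounds _ _ _ _ _ _ n1 d100 qd J0 JM.
rewrite -/p in p0 p1 dp Jp Jp0.
have YE : Y = n%:R - M%:R - d%:R * p + (d - D)%:R * p by rewrite /Y natrB //; ring.
have M0 : 0 <= M%:R :> R by [].
have farY : n%:R <= 2 * M%:R :> R -> n%:R <= 16 / n%:R * Y ^+ 2.
  move=> nM; have Y1 : n%:R / 4 <= - Y.
    rewrite YE; move: (n%:R) (M%:R) (d%:R * p) ((d - D)%:R * p) n1 nM dp Jp Jp0.
    by move=> *; lra.
  have n0' : 0 < n%:R :> R by rewrite ltr0n.
  rewrite mulrAC ler_pdivlMr // -(sqrrN Y).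
  move: (n%:R) (- Y) n0' Y1 => x y x0 xy.
  have : (x / 4) ^+ 2 <= y ^+ 2 by rewrite lerXn2r ?nnegrE; lra.
  by lra.
have nV0 : 0 <= 16 / n%:R :> R by rewrite divr_ge0.
have Y0 : 0 <= 16 / n%:R * Y ^+ 2 by rewrite mulr_ge0 ?sqr_ge0.
have sn : Num.sqrt n%:R <= n%:R :> R.
  by rewrite -[leRHS]ger0_norm // -sqrtr_sqr ler_wsqrtr // expr2 ler_peMl.
have s1 : 1 <= Num.sqrt n%:R :> R by rewrite -[leLHS]sqrtr1 ler_wsqrtr.
have p01 : 0 <= p <= 1 by clear - p0 p1; lra.
have p01' : 0 < p < 1 by clear - p0 p1; lra.
rewrite /B; case: (leqP M n) => Mn; last first.
  have nM : n%:R <= M%:R :> R by rewrite ler_nat ltnW.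
  have far : n%:R <= 16 / n%:R * Y ^+ 2 by apply: farY; clear - nM M0; lra.
  by rewrite mul0r mulr0; clear - far n1; split; lra.
have b0 := binprob_ge0 R D (n - M) p p01.
have bu := binprob_le R D (n - M) p p01 (D2 Mn).
have bl := binprob_ge R D (n - M) p p01' (D0 Mn) (ND Mn).
move: (binprob D (n - M) p) b0 bu bl => b b0.
have Nn : (n - M)%:R = n%:R - M%:R :> R by rewrite natrB.
rewrite Nn -/Y.
have Mn' : M%:R <= n%:R :> R by rewrite ler_nat.
have S0 : 0 <= (n - M).+1%:R :> R by [].
have S1 : (n - M).+1%:R = n%:R - M%:R + 1 :> R by rewrite -natr1 Nn.
have t1 : 1 <= Num.sqrt (n - M).+1%:R :> R by rewrite -[leLHS]sqrtr1 ler_wsqrtr // ler1n.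
have t2 : Num.sqrt (n - M).+1%:R <= 3 / 2 * Num.sqrt n%:R :> R.
  rewrite -(@ler_pXn2r _ 2) ?nnegrE ?sqrtr_ge0 ?mulr_ge0 // exprMn !sqr_sqrtr //.
  by rewrite S1; clear - M0 n1; lra.
have t3 : 2 * M%:R <= n%:R :> R -> Num.sqrt n%:R <= 3 / 2 * Num.sqrt (n - M).+1%:R :> R.
  move=> h; rewrite -(@ler_pXn2r _ 2) ?nnegrE ?sqrtr_ge0 ?mulr_ge0 // exprMn !sqr_sqrtr //.
  by rewrite S1; clear - h M0 n1; lra.
move: (Num.sqrt (n - M).+1%:R) (Num.sqrt n%:R) sn s1 t1 t2 t3 => t s sn s1 t1 t2 t3 bu bl.
have b12 : b <= 12.
  by apply: le_trans bu; rewrite ler_peMr.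
split.
  have [nM|Mn2] := leP (n%:R : R) (2 * M%:R).
    have far := farY nM; have s0 : 0 <= s by clear - s1; lra.
    by have := ler_wpM2r s0 b12; clear - far sn Y0; lra.
  have := ler_wpM2l b0 (t3 (ltW Mn2)); clear - Y0 bu; lra.
apply: (@le_trans _ _ (64 * (b * t))); last first.
  by have := ler_wpM2l b0 t2; lra.
apply: le_trans bl.
apply: le_trans (expR_ge1Dx _); rewrite lerD2l lerN2 [leRHS]mulrC ler_wpM2l ?sqr_ge0 //.
rewrite -[16 / _]invrK lef_pV2 ?posrE ?invr_gt0 ?divr_gt0 //; last first.
- by rewrite ltr0n.
- apply: mulr_gt0; last by clear - p1; lra.
  by apply: mulr_gt0 => //; rewrite ltr0n; exact: D0.
have -> : D%:R = d%:R - (d - D)%:R :> R by rewrite natrB //; ring.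
rewrite invfM invrK mulrBl mulrC.
have h1 : 79 / 100 * n%:R <= d%:R * p - (d - D)%:R * p.
  by clear - dp Jp Mn'; lra.
have h2 : 49 / 50 <= 1 - p by clear - p1; lra.
apply: (@le_trans _ _ (79 / 100 * n%:R * (49 / 50))).
  by clear - n1; lra.
by apply: ler_pM => //; clear - n1; lra.
Qed.

(** * The saddle point estimate *)

(** Comparison with a geometric series of ratio at most [1 / 2]. *)
Lemma sum_expr_tail (R : realFieldType) (z : R) (e : nat -> nat) a L :
  0 <= z <= 1 / 2 -> (forall k, (2 <= k)%N -> (k + a <= e k)%N) ->
  \sum_(2 <= k < L) z ^+ e k <= 2 * z ^+ a.+2.
Proof.
move=> /andP[z0 z1] ea.
have zX k : 0 <= z ^+ k by rewrite exprn_ge0.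
have [L2|L2] := leqP L 2; first by rewrite big_geq // mulr_ge0.
(* The subtracted term makes the bound inductive. *)
suff : \sum_(2 <= k < L) z ^+ e k <= 2 * z ^+ a.+2 - 2 * z ^+ (a + L).
  by move/le_trans; apply; rewrite gerBl mulr_ge0.
elim: L L2 => // L IH; rewrite ltnS leq_eqVlt => /predU1P[<-|L2].
  rewrite big_nat1 (le_trans (ler_wiXn2l _ _ (ea 2 isT))) //; first by lra.
  rewrite addnS addn2 add2n [z ^+ a.+3]exprS; have := zX a.+2.
  by move: (z ^+ a.+2) => y y0; have := ler_wpM2r y0 z1; lra.
rewrite big_nat_recr /=; last exact: ltnW.
have h : z ^+ e L <= z ^+ (a + L).
  by rewrite ler_wiXn2l //; [lra|rewrite addnC ea // ltnW].
have := IH L2; rewrite addnS [z ^+ (a + L).+1]exprS; have := zX (a + L)%N.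
move: h; move: (z ^+ (a + L)) => y h y0; have := ler_wpM2r y0 z1; lra.
Qed.

Lemma sqr_le_expn4 m : (m ^ 2 <= 4 ^ m)%N.
Proof.
have := ltnW (ltn_expl m (isT : 1 < 2)%N).
by rewrite -(leq_exp2r _ _ (isT : 0 < 2)%N) -expnM mulnC expnM.
Qed.

Lemma sum_fourth_moment (R : realFieldType) L (q : R) : 0 <= q <= 1 / 8 ->
  \sum_(2 <= k < L) (q ^+ (k ^ 2) * (k ^ 2)%:R ^+ 2) *+ 2 <= 1024 * q ^+ 4.
Proof.
move=> /andP[q0 q1].
have q4 : 0 <= 4 * q <= 1 / 2 by lra.
have := @sum_expr_tail R _ (fun k => k ^ 2)%N 2 L q4.
have -> : (4 * q) ^+ 4 = 256 * q ^+ 4 by ring.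
move=> /(_ _)/(le_trans _) h; rewrite sumrMnl.
apply: (@le_trans _ _ ((\sum_(2 <= k < L) (4 * q) ^+ (k ^ 2)) *+ 2)).
  rewrite lerMn2r /=; apply: ler_sum => k _.
  rewrite exprMn mulrC ler_wpM2r ?exprn_ge0 // -!natrX ler_nat.
  exact: sqr_le_expn4.
rewrite -mulr_natl; have : \sum_(2 <= k < L) (4 * q) ^+ (k ^ 2) <= 2 * (256 * q ^+ 4).
  by apply: h => // k k2; nia.
lra.
Qed.


(** The mean [mu] and the total weight [Z] are those of one coordinate; the
    hypothesis on [mu] is the saddle point equation up to a small error.  Large
    coordinates have total variance of order [d q ^ 4], which is small compared
    with [n], so that the second moment of [Y] is at most [n / 32] and the
    corrections in [binprob_bounds] have averages at most [1 / 2]. *)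
Lemma card_sphere_saddle (R : realType) L n d (q : R) :
  let Z := coord_gf L (1 + 2 * q) q in
  let mu :=
    (2 * q + \sum_(2 <= k < L) (q ^+ (k ^ 2) * (k ^ 2)%:R) *+ 2) / Z in
  (1 < L)%N -> (n < L)%N -> (0 < n)%N -> (100 * n <= d)%N ->
  7 * n%:R <= 16 * (d%:R * q) <= 9 * n%:R ->
  `|n%:R - d%:R * mu| <= 1 / 8 ->
  (card_sphere n d)%:R * q ^+ n * Num.sqrt n%:R <= 27 * Z ^+ d /\
  Z ^+ d <= 192 * ((card_sphere n d)%:R * q ^+ n * Num.sqrt n%:R).
Proof.
move=> Z mu L1 nL n0 nd qd sad.
have n1 : 1 <= n%:R :> R by rewrite ler1n.
have d100 : 100 * n%:R <= d%:R :> R by rewrite -natrM ler_nat.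
have := @tilt_bounds R _ _ 0 0 _ n1 d100 qd (lexx _).
rewrite mulr0 => /(_ (lexx _)) [q0 p0 p1 _ _].
set p := 2 * q / (1 + 2 * q) in p0 p1.
have w0 : 0 < 1 + 2 * q by clear - q0; lra.
have d0 : 0 < d%:R :> R by clear - n1 d100; lra.
have qs : q <= 9 / 1600.
  by rewrite -(ler_pM2l d0); case/andP: qd => _; clear - d100; lra.
have qX k : 0 <= q ^+ k by rewrite exprn_ge0 // ltW.
pose S0 := \sum_(2 <= k < L) q ^+ (k ^ 2) *+ 2.
pose S1 := \sum_(2 <= k < L) (q ^+ (k ^ 2) * (k ^ 2)%:R) *+ 2.
pose S2 := \sum_(2 <= k < L) (q ^+ (k ^ 2) * (k ^ 2)%:R ^+ 2) *+ 2.
have S0_ge0 : 0 <= S0 by apply: sumr_ge0 => k _; rewrite mulrn_wge0.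
have S01 : S0 <= S1.
  rewrite /S0 /S1 !big_nat; apply: ler_sum => k /andP[k2 _].
  by rewrite lerMn2r /= ler_peMr // ler1n expn_gt0 (ltn_trans _ k2).
have S2_ge0 : 0 <= S2.
  by apply: sumr_ge0 => k _; rewrite mulrn_wge0 // mulr_ge0 // sqr_ge0.
have ZE : Z = 1 + 2 * q + S0 by [].
have Z1 : 1 <= Z by clear - ZE S0_ge0 q0; lra.
have Z0 : 0 < Z by clear - Z1; lra.
have pE : (1 + 2 * q) * p = 2 * q by rewrite mulrC divfK // gt_eqF.
pose v := ((1 + 2 * q) * p ^+ 2 + S2) / Z - mu ^+ 2.
have m1 : (1 + 2 * q) * p + S1 = Z * mu by rewrite pE /mu [RHS]mulrC divfK // gt_eqF.
have m2 : (1 + 2 * q) * p ^+ 2 + S2 = Z * (v + mu ^+ 2).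
  by rewrite /v subrK [RHS]mulrC divfK // gt_eqF.
(* The variance is at most the second moment about [p],
   to which small coordinates do not contribute. *)
have vS : v <= S2.
  have : Z * v = S2 - p * (2 * S1 - p * S0) - Z * (mu - p) ^+ 2.
    have -> : Z * (mu - p) ^+ 2 =
      Z * mu * (mu - 2 * p) + (1 + 2 * q + S0) * p ^+ 2 by rewrite ZE; ring.
    have -> : Z * v = (1 + 2 * q) * p ^+ 2 + S2 - (Z * mu) * mu by rewrite m2; ring.
    by rewrite -m1; ring.
  have : 0 <= p * (2 * S1 - p * S0).
    rewrite mulr_ge0 ?(ltW p0) // subr_ge0.
    by have := ler_wpM2r S0_ge0 p1; clear - S01 S0_ge0; lra.
  have : 0 <= Z * (mu - p) ^+ 2 by rewrite mulr_ge0 ?sqr_ge0 // ltW.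
  have := ler_wpM2r S2_ge0 Z1; rewrite mul1r => h h1 h2 h3.
  by rewrite -(ler_pM2l Z0) h3; clear - h h1 h2; lra.
have dv : d%:R * v <= n%:R / 64.
  apply: le_trans (ler_wpM2l (ltW d0) vS) _.
  have q8 : 0 <= q <= 1 / 8 by clear - q0 qs; lra.
  apply: le_trans (ler_wpM2l (ltW d0) (sum_fourth_moment _ L _ q8)) _.
  have q40 : q <= 1 / 40 by clear - qs; lra.
  have x0 : 0 <= d%:R * q by rewrite mulr_ge0 // ltW.
  have -> : d%:R * (1024 * q ^+ 4) = 1024 * (d%:R * q * q * q * q) by ring.
  case/andP: qd => _; move: (d%:R * q) x0 => x x0 xn.
  have x1 : x * q <= x / 40 by have := ler_wpM2l x0 q40; clear; lra.
  have xq0 : 0 <= x * q by rewrite mulr_ge0 // ltW.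
  have x2 : x * q * q <= x * q / 40 by have := ler_wpM2l xq0 q40; clear; lra.
  have xqq0 : 0 <= x * q * q by rewrite mulr_ge0 // ltW.
  have x3 : x * q * q * q <= x * q * q / 40 by have := ler_wpM2l xqq0 q40; clear; lra.
  clear - n1 xn x1 x2 x3; lra.
pose e := (n%:R - d%:R * mu) ^+ 2 + d%:R * v.
have e_le : 16 / n%:R * e <= 1 / 2.
  have : (n%:R - d%:R * mu) ^+ 2 <= (1 / 8) ^+ 2.
    by rewrite -real_normK ?num_real // lerXn2r ?nnegrE.
  move=> h; rewrite mulrAC ler_pdivrMr; last by rewrite ltr0n.
  by rewrite /e; clear - h dv n1; lra.
pose W D M := (1 + 2 * q) ^+ D * q ^+ M.
pose Y D M := n%:R - M%:R - D%:R * p.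
pose B D M : R := if (M <= n)%N then binprob D (n - M) p else 0.
have W0 D M : 0 <= W D M by rewrite mulr_ge0 // exprn_ge0 // ltW.
have LW : largesum L d W = Z ^+ d.
  rewrite -[RHS]mul1r -largesum_exp; apply: eq_largesum => D M.
  by rewrite mul1r.
have LY : largesum L d (fun D M => W D M * Y D M ^+ 2) = Z ^+ d * e.
  exact: (@largesum_second_moment _ _ _ _ _ _ _ _ _ m1 m2).
have LS : (card_sphere n d)%:R * q ^+ n * Num.sqrt n%:R =
    largesum L d (fun D M => W D M * (B D M * Num.sqrt n%:R)).
  rewrite (card_sphere_largesum _ _ _ _ L1 nL).
  rewrite -mulrA [LHS]mulrC -largesumZ.
  apply: eq_largesum => D M; rewrite /B /W.
  case: (leqP M n) => Mn; last by rewrite !(mul0r, mulr0).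
  have := binprob_tilt R D (n - M) q q0; rewrite -/p => h.
  have -> : q ^+ n = q ^+ M * q ^+ (n - M) by rewrite -exprD subnKC.
  transitivity (Num.sqrt n%:R * q ^+ M * (('C(D, n - M) * 2 ^ (n - M))%:R * q ^+ (n - M))).
    by ring.
  by rewrite -h; ring.
have bounds D M Dd dM := binprob_bounds R n d D M q n0 nd qd Dd dM.
have Zd : 0 < Z ^+ d by rewrite exprn_gt0.
split.
  rewrite LS; apply: (@le_trans _ _ (largesum L d (fun D M =>
      18 * W D M + 18 * (16 / n%:R) * (W D M * Y D M ^+ 2)))).
    apply: ler_largesum => D M Dd dM; have [h _] := bounds D M Dd dM.
    apply: le_trans (ler_wpM2l (W0 D M) h) _.
    by rewrite le_eqVlt; apply/orP; left; apply/eqP; rewrite /Y -/p; ring.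
  rewrite largesumD !largesumZ LW LY.
  have -> : 18 * Z ^+ d + 18 * (16 / n%:R) * (Z ^+ d * e) =
    Z ^+ d * (18 + 18 * (16 / n%:R * e)) by ring.
  by rewrite [leRHS]mulrC ler_pM2l //; clear - e_le; lra.
rewrite LS; apply: (@le_trans _ _ (2 * largesum L d (fun D M =>
      W D M + (- (16 / n%:R)) * (W D M * Y D M ^+ 2)))).
  rewrite largesumD largesumZ LW LY.
  have -> : Z ^+ d + (- (16 / n%:R)) * (Z ^+ d * e) =
    Z ^+ d * (1 - (16 / n%:R * e)) by ring.
  have := ler_wpM2l (ltW Zd) e_le; rewrite mulrBr; clear; lra.
rewrite -!largesumZ; apply: ler_largesum => D M Dd dM.
have [_ h] := bounds D M Dd dM.
have := ler_wpM2l (W0 D M) h; rewrite -/p -/(Y D M) -/(B D M).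
move: (Y D M ^+ 2) (B D M * _) (W D M) (16 / n%:R) => y b w c.
rewrite mulrBr mulr1; have -> : w * (c * y) = c * (w * y) by ring.
lra.
Qed.

(** * Weighted norm and truncation of polynomials *)

(** Being submultiplicative, this norm is easily bounded along polynomial
    recursions, and it bounds all values on the disc of radius [r]. *)
Definition pnorm {R : numDomainType} (r : R) (P : {poly R}) : R :=
  \sum_(i < size P) `|P`_i| * r ^+ i.

Lemma pnormE (R : numDomainType) (r : R) (P : {poly R}) n : (size P <= n)%N ->
  pnorm r P = \sum_(i < n) `|P`_i| * r ^+ i.
Proof.
move=> Pn; rewrite /pnorm (big_ord_widen n (fun i => `|P`_i| * r ^+ i)) //.
rewrite big_mkcond; apply: eq_bigr => i _; case: ifP => // /negbT.
by rewrite -leqNgt => Pi; rewrite nth_default // normr0 mul0r.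
Qed.

(** Reduces the properties of the norm to the induction [poly_ind]. *)
Lemma pnorm_cons (R : numDomainType) (r c : R) (P : {poly R}) :
  pnorm r (P * 'X + c%:P) = pnorm r P * r + `|c|.
Proof.
rewrite (@pnormE _ _ _ (size P).+1).
  rewrite big_ord_recl /= coefD coefMX coefC /= add0r expr0 mulr1 addrC.
  congr (_ + _); rewrite mulr_suml; apply: eq_bigr => i _.
  by rewrite coefD coefMX coefC /= addr0 exprSr mulrA.
by rewrite -cons_poly_def size_cons_poly; case: ifP.
Qed.

Lemma pnorm0 (R : numDomainType) (r : R) : pnorm r 0 = 0.
Proof. by rewrite /pnorm size_poly0 big_ord0. Qed.

Lemma pnormC (R : numDomainType) (r c : R) : pnorm r c%:P = `|c|.
Proof. by rewrite -[c%:P]add0r -[0](mul0r 'X) pnorm_cons pnorm0 mul0r add0r. Qed.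

Lemma pnormMX (R : numDomainType) (r : R) P : pnorm r (P * 'X) = pnorm r P * r.
Proof. by rewrite -[P * 'X]addr0 -(polyC0 R) pnorm_cons normr0 addr0. Qed.

Lemma pnormX (R : numDomainType) (r : R) : pnorm r 'X = r.
Proof. by rewrite -['X]mul1r pnormMX pnormC normr1 mul1r. Qed.

Lemma pnorm_ge0 (R : numDomainType) (r : R) P : 0 <= r -> 0 <= pnorm r P.
Proof. by move=> r0; apply: sumr_ge0 => i _; rewrite mulr_ge0 // exprn_ge0. Qed.

Lemma pnormD (R : numDomainType) (r : R) P Q : 0 <= r ->
  pnorm r (P + Q) <= pnorm r P + pnorm r Q.
Proof.
move=> r0; rewrite (@pnormE _ _ (P + Q) _ (size_polyD P Q)).
rewrite (@pnormE _ _ P _ (leq_maxl _ (size Q))).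
rewrite (@pnormE _ _ Q _ (leq_maxr (size P) _)) -big_split /=.
apply: ler_sum => i _; rewrite coefD -mulrDl ler_wpM2r ?exprn_ge0 //.
exact: ler_normD.
Qed.

Lemma pnormN (R : numDomainType) (r : R) P : pnorm r (- P) = pnorm r P.
Proof. by rewrite /pnorm size_polyN; apply: eq_bigr => i _; rewrite coefN normrN. Qed.

Lemma pnormCM (R : numDomainType) (r c : R) P :
  pnorm r (c%:P * P) = `|c| * pnorm r P.
Proof.
elim/poly_ind: P => [|P a IH]; first by rewrite mulr0 pnorm0 mulr0.
by rewrite mulrDr mulrA -polyCM !pnorm_cons IH normrM mulrDr mulrA.
Qed.

Lemma pnormM (R : numDomainType) (r : R) P Q : 0 <= r ->
  pnorm r (P * Q) <= pnorm r P * pnorm r Q.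
Proof.
move=> r0; elim/poly_ind: P => [|P c IH].
  by rewrite mul0r pnorm0 mul0r.
rewrite mulrDl -mulrA ['X * Q]mulrC mulrA pnorm_cons mulrDl.
apply: le_trans (pnormD _ _ _ _ r0) _; rewrite pnormMX pnormCM lerD2r.
by rewrite mulrAC ler_wpM2r.
Qed.

Lemma pnorm_exp (R : numDomainType) (r : R) P n : 0 <= r ->
  pnorm r (P ^+ n) <= pnorm r P ^+ n.
Proof.
move=> r0; elim: n => [|n IH]; first by rewrite !expr0 pnormC normr1.
rewrite !exprS; apply: le_trans (pnormM _ _ _ _ r0) _.
by rewrite ler_wpM2l // pnorm_ge0.
Qed.

Lemma pnorm_sum (R : numDomainType) (r : R) (I : Type) (s : seq I)
    (F : I -> {poly R}) : 0 <= r ->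
  pnorm r (\sum_(i <- s) F i) <= \sum_(i <- s) pnorm r (F i).
Proof.
move=> r0; elim: s => [|i s IH]; first by rewrite !big_nil pnorm0.
by rewrite !big_cons; apply: le_trans (pnormD _ _ _ _ r0) _; rewrite lerD2l.
Qed.

Lemma pnorm_horner (R : numDomainType) (r x : R) P : `|x| <= r ->
  `|P.[x]| <= pnorm r P.
Proof.
move=> xr; have r0 := le_trans (normr_ge0 x) xr.
elim/poly_ind: P => [|P c IH]; first by rewrite horner0 normr0 pnorm0.
rewrite !hornerE pnorm_cons; apply: le_trans (ler_normD _ _) _.
by rewrite lerD2r normrM ler_pM.
Qed.

Definition eqmodX {R : fieldType} (N : nat) (P Q : {poly R}) : bool :=
  'X^N %| P - Q.

Lemma eqmodX_refl (R : fieldType) N (P : {poly R}) : eqmodX N P P.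
Proof. by rewrite /eqmodX subrr dvdp0. Qed.

Lemma eqmodX_trans (R : fieldType) N (P Q S : {poly R}) :
  eqmodX N P Q -> eqmodX N Q S -> eqmodX N P S.
Proof.
move=> h1 h2; rewrite /eqmodX; have -> : P - S = (P - Q) + (Q - S) by ring.
exact: dvdp_add.
Qed.

Lemma eqmodXD (R : fieldType) N (P Q S T : {poly R}) :
  eqmodX N P Q -> eqmodX N S T -> eqmodX N (P + S) (Q + T).
Proof.
move=> h1 h2; rewrite /eqmodX; have -> : P + S - (Q + T) = (P - Q) + (S - T) by ring.
exact: dvdp_add.
Qed.

Lemma eqmodXN (R : fieldType) N (P Q : {poly R}) :
  eqmodX N P Q -> eqmodX N (- P) (- Q).
Proof. by rewrite /eqmodX -opprD dvdpNr. Qed.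

Lemma eqmodXM (R : fieldType) N (P Q S T : {poly R}) :
  eqmodX N P Q -> eqmodX N S T -> eqmodX N (P * S) (Q * T).
Proof.
move=> h1 h2; rewrite /eqmodX.
have -> : P * S - Q * T = (P - Q) * S + Q * (S - T) by ring.
by apply: dvdp_add; [exact: dvdp_mulr | exact: dvdp_mull].
Qed.

Lemma eqmodX_exp (R : fieldType) N (P Q : {poly R}) n :
  eqmodX N P Q -> eqmodX N (P ^+ n) (Q ^+ n).
Proof.
move=> h; elim: n => [|n IH]; first by rewrite !expr0 eqmodX_refl.
by rewrite !exprS; exact: eqmodXM.
Qed.

Lemma eqmodX_sum (R : fieldType) N (I : Type) (s : seq I) (F G : I -> {poly R}) :
  (forall i, eqmodX N (F i) (G i)) ->
  eqmodX N (\sum_(i <- s) F i) (\sum_(i <- s) G i).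
Proof.
move=> h; elim: s => [|i s IH]; first by rewrite !big_nil eqmodX_refl.
by rewrite !big_cons; exact: eqmodXD.
Qed.

Lemma eqmodXS (R : fieldType) N (P Q : {poly R}) :
  eqmodX N P Q -> eqmodX N.+1 ('X * P) ('X * Q).
Proof. by rewrite /eqmodX -mulrBr exprS; exact: dvdp_mul. Qed.

Lemma eqmodX0 (R : fieldType) N n (P Q : {poly R}) :
  (N <= n)%N -> eqmodX N (P * 'X^n * Q) 0.
Proof.
by move=> Nn; rewrite /eqmodX subr0 dvdp_mulr // dvdp_mull // dvdp_exp2l.
Qed.

Lemma eqmodX_leq (R : fieldType) N n (P Q : {poly R}) :
  (n <= N)%N -> eqmodX N P Q -> eqmodX n P Q.
Proof. by move=> nN; apply: dvdp_trans; exact: dvdp_exp2l. Qed.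

Lemma eqmodX_coef (R : fieldType) N (P Q : {poly R}) :
  reflect (forall k, (k < N)%N -> P`_k = Q`_k) (eqmodX N P Q).
Proof.
apply: (iffP idP) => [/dvdpP[A e] k kN|e].
  by apply/eqP; rewrite -subr_eq0 -coefB e coefMXn kN.
rewrite /eqmodX -[P - Q](poly_take_drop N).
rewrite (_ : take_poly N _ = 0) ?add0r ?dvdp_mull //.
apply/polyP => k; rewrite coef_take_poly coef0; case: ifP => // kN.
by rewrite coefB e // subrr.
Qed.

(** A polynomial divisible by [X ^ N] and bounded in norm at radius [r] is
    geometrically small strictly inside that radius: this turns formal
    convergence into numerical convergence. *)
Lemma pnorm_horner_eqmodX (R : numFieldType) (r x : R) N (P : {poly R}) :
  0 < r -> `|x| <= r -> eqmodX N P 0 -> `|P.[x]| <= pnorm r P * (`|x| / r) ^+ N.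
Proof.
move=> r0 xr; rewrite /eqmodX subr0 => /dvdpP[A ->].
have -> : pnorm r (A * 'X^N) = pnorm r A * r ^+ N.
  elim: N => [|N IH]; first by rewrite !expr0 !mulr1.
  by rewrite !exprSr !mulrA pnormMX IH.
rewrite hornerM hornerXn normrM normrX expr_div_n -mulrA [r ^+ N * _]mulrC.
rewrite divfK ?expf_neq0 ?gt_eqF // ler_wpM2r ?exprn_ge0 //.
exact: pnorm_horner.
Qed.

(** * Power series as limits of polynomials with stable coefficients *)

Local Open Scope classical_set_scope.

(** For a sequence of polynomials whose [N]-th term determines the coefficients
    below [N], the coefficients of the formal limit. *)
Definition stable_coef {R : fieldType} (G : nat -> {poly R}) (k : nat) : R :=
  (G k.+1)`_k.

Lemma eqmodX_stable (R : fieldType) (G : nat -> {poly R}) N n :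
  (forall m, eqmodX m (G m.+1) (G m)) -> (N <= n)%N -> eqmodX N (G n) (G N).
Proof.
move=> st; elim: n => [|n IH]; first by rewrite leqn0 => /eqP->; exact: eqmodX_refl.
rewrite leq_eqVlt => /predU1P[->|]; first exact: eqmodX_refl.
rewrite ltnS => Nn; apply: eqmodX_trans (IH Nn).
exact: eqmodX_leq Nn (st n).
Qed.

Lemma stable_coefE (R : fieldType) (G : nat -> {poly R}) N k :
  (forall m, eqmodX m (G m.+1) (G m)) -> (k < N)%N ->
  stable_coef G k = (G N)`_k.
Proof.
move=> st kN; have := eqmodX_stable _ _ _ _ st kN.
by move=> /eqmodX_coef/(_ k (ltnSn k)).
Qed.

Lemma pnorm_partial_le (R : numDomainType) (r : R) (P : {poly R}) N : 0 <= r ->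
  \sum_(0 <= k < N) `|P`_k| * r ^+ k <= pnorm r P.
Proof.
move=> r0; rewrite (@pnormE _ _ P _ (leq_maxr N _)).
rewrite -(big_mkord xpredT (fun k => `|P`_k| * r ^+ k)).
rewrite [leRHS](big_cat_nat (n := N)) ?leq_maxl //= lerDl.
by apply: sumr_ge0 => i _; rewrite mulr_ge0 // exprn_ge0.
Qed.

Lemma stable_coef_sum_le (R : numFieldType) (r M : R) (G : nat -> {poly R}) N :
  0 <= r -> (forall m, pnorm r (G m) <= M) ->
  (forall m, eqmodX m (G m.+1) (G m)) ->
  \sum_(0 <= k < N) `|stable_coef G k| * r ^+ k <= M.
Proof.
move=> r0 bd st; apply: le_trans (bd N).
apply: le_trans (pnorm_partial_le _ _ _ N r0); rewrite !big_nat.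
apply: ler_sum => k /andP[_ kN]; by rewrite (stable_coefE _ _ N).
Qed.

Lemma stable_coef_tail_le (R : numFieldType) (r M x : R) (G : nat -> {poly R}) m N :
  0 < r -> `|x| <= r -> (forall m, pnorm r (G m) <= M) ->
  (forall m, eqmodX m (G m.+1) (G m)) ->
  \sum_(m <= k < N) `|stable_coef G k * x ^+ k| <= M * (`|x| / r) ^+ m.
Proof.
move=> r0 xr bd st; have rho0 : 0 <= `|x| / r by rewrite divr_ge0 // ltW.
have rho1 : `|x| / r <= 1 by rewrite ler_pdivrMr // mul1r.
have [mN|Nm] := leqP m N; last first.
  rewrite big_geq ?(ltnW Nm) // mulr_ge0 ?exprn_ge0 //.
  by apply: le_trans (bd 0%N); rewrite pnorm_ge0 // ltW.
apply: (@le_trans _ _ (\sum_(0 <= k < N)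
    (`|stable_coef G k| * r ^+ k) * (`|x| / r) ^+ m)); last first.
  rewrite -mulr_suml ler_wpM2r ?exprn_ge0 //.
  by apply: stable_coef_sum_le => //; exact: ltW.
rewrite [leRHS](big_cat_nat (n := m)) //=.
apply: (@le_trans _ _ (\sum_(m <= k < N)
    (`|stable_coef G k| * r ^+ k) * (`|x| / r) ^+ m)); last first.
  rewrite lerDr; apply: sumr_ge0 => k _.
  by rewrite !mulr_ge0 ?exprn_ge0 // ltW.
rewrite !big_nat; apply: ler_sum => k /andP[mk _].
rewrite normrM normrX -mulrA ler_wpM2l //.
rewrite -[leLHS](@divfK _ (r ^+ k)) ?expf_neq0 ?gt_eqF // -expr_div_n mulrC.
by rewrite ler_wpM2l ?exprn_ge0 ?(ltW r0) // ler_wiXn2l.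
Qed.

Lemma cvg_pseries_stable_coef (R : realType) (r M x : R) (G : nat -> {poly R}) :
  0 < r -> `|x| <= r -> (forall m, pnorm r (G m) <= M) ->
  (forall m, eqmodX m (G m.+1) (G m)) -> cvgn (pseries (stable_coef G) x).
Proof.
move=> r0 xr bd st; apply: normed_cvg; apply: nondecreasing_is_cvgn.
  by apply: nondecreasing_series => k _ _ /=; exact: normr_ge0.
exists M => _ [N _ <-] /=; rewrite /series /=.
have := stable_coef_tail_le _ _ _ _ _ 0 N r0 xr bd st.
by rewrite expr0 mulr1.
Qed.

(** The terms of index at least [m] gain a factor [(`|x| / r) ^ m] over those at
    radius [r], whose sum is at most [M]; this gives the error terms [O_K]. *)
Lemma pseries_stable_coef_tail (R : realType) (r M x : R) (G : nat -> {poly R}) m :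
  0 < r -> `|x| <= r -> (forall m, pnorm r (G m) <= M) ->
  (forall m, eqmodX m (G m.+1) (G m)) ->
  `|limn (pseries (stable_coef G) x) -
    \sum_(0 <= k < m) stable_coef G k * x ^+ k| <= M * (`|x| / r) ^+ m.
Proof.
move=> r0 xr bd st; have cv := cvg_pseries_stable_coef _ _ _ _ _ r0 xr bd st.
set S := \sum_(_ <= _ < _) _.
have near_S : \forall N \near \oo, `|pseries (stable_coef G) x N - S| <= M * (`|x| / r) ^+ m.
  near=> N; have mN : (m <= N)%N by near: N; exact: nbhs_infty_ge.
  rewrite /pseries /series /= (big_cat_nat (n := m)) //= -/S [S + _]addrC addrK.
  apply: le_trans (ler_norm_sum _ _ _) _.
  exact: stable_coef_tail_le.
rewrite ler_norml lerBlDr lerBrDr; apply/andP; split.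
  apply: limr_ge => //; apply: filterS near_S => N.
  by rewrite ler_norml => /andP[h _]; rewrite -lerBrDr.
apply: limr_le => //; apply: filterS near_S => N.
by rewrite ler_norml => /andP[_ h]; rewrite -lerBlDr.
Unshelve. all: by end_near. Qed.

Lemma pseries_stable_coef_approx (R : realType) (r M x : R) (G : nat -> {poly R}) N :
  0 < r -> `|x| <= r -> (forall m, pnorm r (G m) <= M) ->
  (forall m, eqmodX m (G m.+1) (G m)) ->
  `|(G N).[x] - limn (pseries (stable_coef G) x)| <= 3 * M * (`|x| / r) ^+ N.
Proof.
move=> r0 xr bd st; have tail := pseries_stable_coef_tail _ _ _ _ _ N r0 xr bd st.
pose T := \poly_(k < N) stable_coef G k.
have TE : T.[x] = \sum_(0 <= k < N) stable_coef G k * x ^+ k.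
  by rewrite horner_poly big_mkord.
have nT : pnorm r T <= M.
  rewrite (@pnormE _ _ _ N) ?size_poly //.
  have := stable_coef_sum_le _ _ _ _ N (ltW r0) bd st.
  rewrite big_mkord; apply: le_trans; apply: ler_sum => k _.
  by rewrite coef_poly ltn_ord.
have GT : eqmodX N (G N - T) 0.
  apply/eqmodX_coef => k kN.
  by rewrite coefB coef_poly kN (stable_coefE _ _ N) // subrr coef0.
have := pnorm_horner_eqmodX _ _ _ _ _ r0 xr GT.
rewrite hornerD hornerN TE => h.
have nGT : pnorm r (G N - T) <= 2 * M.
  apply: le_trans (pnormD _ _ _ _ (ltW r0)) _.
  by rewrite pnormN mulr_natl mulr2n lerD.
have rho0 : 0 <= (`|x| / r) ^+ N by rewrite exprn_ge0 // divr_ge0 // ltW.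
have h2 := le_trans h (ler_wpM2r rho0 nGT).
rewrite distrC in tail; apply: le_trans (ler_distD _ _ _) (le_trans (lerD h2 tail) _).
by rewrite -mulrDl; have -> : 2 * M + M = 3 * M by ring.
Qed.

Local Close Scope classical_set_scope.

(** * The saddle point recursion *)

(** Let [x] be [n / d] and [q = x s / 2].  The equation [q theta'(q) = x theta(q)]
    reads [s = 1 + x * saddle_step s] once the terms of [theta'] and [theta] of
    equal degree are merged; writing [s = 1 + x t] makes it a fixed point
    equation for [t].  Extracting the factor [x] is what makes the iteration
    gain one coefficient at each step. *)
Definition saddle_step {R : fieldType} (L : nat) (s : {poly R}) : {poly R} :=
  s * (1 - \sum_(2 <= k < L)
    ((k ^ 2)%:R - 'X) * (2^-1%:P * s) * (2^-1%:P * 'X * s) ^+ (k ^ 2 - 2)).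

(** The truncation level grows with the iteration, so that the formal limit
    involves all of theta. *)
Fixpoint saddle_t {R : fieldType} (N : nat) : {poly R} :=
  if N is N'.+1 then saddle_step N'.+3 (1 + 'X * saddle_t N') else 0.

Definition saddle_s {R : fieldType} (N : nat) : {poly R} := 1 + 'X * saddle_t N.

(** The quotient [(theta(q) - 1) / x] for [q = x s / 2]. *)
Definition theta_v {R : fieldType} (N : nat) : {poly R} :=
  saddle_s N *
  (1 + \sum_(2 <= k < N.+3) (2^-1%:P * 'X * saddle_s N) ^+ (k ^ 2 - 1)).

(** The value of [lnpoly N] at [X P], divided by [X]; working with the quotient keeps
    it a polynomial. *)
Definition lnquot {R : fieldType} (N : nat) (P : {poly R}) : {poly R} :=
  \sum_(k < N) ((-1) ^+ k / k.+1%:R)%:P * 'X^k * P ^+ k.+1.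

(** Approximation of [ln theta(q) / x - ln s - 1]. *)
Definition rate_poly {R : fieldType} (N : nat) : {poly R} :=
  lnquot N (theta_v N) - 'X * lnquot N (saddle_t N) - 1.

Lemma saddle_tS (R : fieldType) N :
  saddle_t N.+1 = saddle_step N.+3 (saddle_s N) :> {poly R}.
Proof. by []. Qed.

Lemma eqmodX_saddle_step (R : fieldType) N L (P Q : {poly R}) :
  eqmodX N P Q -> eqmodX N (saddle_step L P) (saddle_step L Q).
Proof.
move=> PQ; apply: eqmodXM => //; apply: eqmodXD; first exact: eqmodX_refl.
apply: eqmodXN; apply: eqmodX_sum => k; apply: eqmodXM; last apply: eqmodX_exp.
  by apply: eqmodXM; rewrite ?eqmodX_refl //; apply: eqmodXM; rewrite ?eqmodX_refl.
by apply: eqmodXM; rewrite ?eqmodX_refl.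
Qed.

Lemma saddle_stepS (R : fieldType) N L (s : {poly R}) : (2 <= L)%N -> (N <= L ^ 2 - 2)%N ->
  eqmodX N (saddle_step L.+1 s) (saddle_step L s).
Proof.
move=> L2 NL; apply: eqmodXM; first exact: eqmodX_refl.
apply: eqmodXD; first exact: eqmodX_refl.
apply: eqmodXN; rewrite big_nat_recr //= -[X in eqmodX _ _ X]addr0.
apply: eqmodXD; first exact: eqmodX_refl.
set m := (L ^ 2 - 2)%N; rewrite [2^-1%:P * 'X * s]mulrAC exprMn mulrA.
by rewrite -[_ * 'X^m]mulr1; exact: eqmodX0.
Qed.

Lemma saddle_t_stable (R : fieldType) N :
  eqmodX N (saddle_t N.+1) (saddle_t N : {poly R}).
Proof.
elim: N => [|N IH]; first by rewrite /eqmodX expr0 dvd1p.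
rewrite 2!saddle_tS; apply: (eqmodX_trans _ _ _ (saddle_step N.+4 (saddle_s N))).
  apply: eqmodX_saddle_step; apply: eqmodXD; first exact: eqmodX_refl.
  exact: eqmodXS.
by apply: saddle_stepS => //; nia.
Qed.

Lemma saddle_s_stable (R : fieldType) N :
  eqmodX N (saddle_s N.+1) (saddle_s N : {poly R}).
Proof.
apply: eqmodXD; first exact: eqmodX_refl.
by apply: eqmodXM; [exact: eqmodX_refl | exact: saddle_t_stable].
Qed.

Lemma theta_v_stable (R : fieldType) N :
  eqmodX N (theta_v N.+1) (theta_v N : {poly R}).
Proof.
have st := saddle_s_stable R N.
apply: eqmodXM => //; apply: eqmodXD; first exact: eqmodX_refl.
rewrite big_nat_recr //= -[X in eqmodX _ _ X]addr0; apply: eqmodXD.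
  apply: eqmodX_sum => k; apply: eqmodX_exp.
  by apply: eqmodXM; rewrite ?eqmodX_refl.
rewrite mulrAC exprMn -[_ * 'X^_]mulr1; apply: eqmodX0; nia.
Qed.

Lemma eqmodX_lnquot (R : fieldType) N n (P Q : {poly R}) :
  eqmodX N P Q -> eqmodX N (lnquot n P) (lnquot n Q).
Proof.
move=> PQ; apply: eqmodX_sum => k; apply: eqmodXM; first exact: eqmodX_refl.
exact: eqmodX_exp.
Qed.

Lemma lnquot_stable (R : fieldType) N (P : {poly R}) :
  eqmodX N (lnquot N.+1 P) (lnquot N P).
Proof.
rewrite /lnquot big_ord_recr /= -[X in eqmodX _ _ X]addr0.
by apply: eqmodXD; [exact: eqmodX_refl | exact: eqmodX0].
Qed.

Lemma rate_poly_stable (R : fieldType) N :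
  eqmodX N (rate_poly N.+1) (rate_poly N : {poly R}).
Proof.
apply: eqmodXD; last exact: eqmodX_refl.
apply: eqmodXD.
  apply: eqmodX_trans (lnquot_stable _ _ _).
  by apply: eqmodX_lnquot; exact: theta_v_stable.
apply: eqmodXN; apply: eqmodXM; first exact: eqmodX_refl.
apply: eqmodX_trans (lnquot_stable _ _ _).
by apply: eqmodX_lnquot; exact: saddle_t_stable.
Qed.

Lemma pnormXM (R : numDomainType) (r : R) P : pnorm r ('X * P) = r * pnorm r P.
Proof. by rewrite mulrC pnormMX mulrC. Qed.

Lemma pnorm_tail_le (R : realFieldType) (r z : R) (P : {poly R}) e a L :
  0 <= r -> pnorm r P <= z -> z <= 1 / 2 ->
  (forall k, (2 <= k)%N -> (k + a <= e k)%N) ->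
  \sum_(2 <= k < L) pnorm r (P ^+ e k) <= 2 * z ^+ a.+2.
Proof.
move=> r0 Pz z1 ea; have z0 : 0 <= z := le_trans (pnorm_ge0 _ _ P r0) Pz.
apply: le_trans (sum_expr_tail _ z e a L _ ea); last by rewrite z0.
apply: ler_sum => k _; apply: le_trans (pnorm_exp _ _ _ _ r0) _.
by apply: lerXn2r; rewrite ?nnegrE ?pnorm_ge0.
Qed.

Lemma sqrn_le_expn2 k : (2 <= k)%N -> ((k ^ 2).+1 <= 4 * 2 ^ (k ^ 2 - 2))%N.
Proof.
move=> k2; rewrite -[4%N]/(2 ^ 2)%N -expnD subnKC; first exact: ltn_expl.
by rewrite -mulnn; nia.
Qed.

Lemma pnorm_half_Xs (R : realFieldType) (s : {poly R}) :
  pnorm (1 / 16) s <= 9 / 8 ->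
  pnorm (1 / 16) (2^-1%:P * 'X * s) <= 9 / 256.
Proof.
move=> sn; rewrite -mulrA pnormCM pnormXM ger0_norm ?invr_ge0 //; lra.
Qed.

(** The ball of radius 2 is invariant under the recursion for [saddle_t]: the
    quadratic exponents make the sum negligible at radius [1 / 16]. *)
Lemma pnorm_saddle_step (R : realFieldType) L (s : {poly R}) :
  pnorm (1 / 16) s <= 9 / 8 -> pnorm (1 / 16) (saddle_step L s) <= 2.
Proof.
move=> sn; have r0 : 0 <= 1 / 16 :> R by lra.
have s0 := pnorm_ge0 _ _ s r0.
pose y := (2^-1%:P * 'X * s : {poly R}).
have yn : pnorm (1 / 16) y <= 9 / 256 := pnorm_half_Xs _ _ sn.
apply: le_trans (pnormM _ _ _ _ r0) _.
pose S := \sum_(2 <= k < L) ((k ^ 2)%:R - 'X) * (2^-1%:P * s) * y ^+ (k ^ 2 - 2).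
have SN : pnorm (1 / 16) S <= 1 / 2.
  apply: le_trans (pnorm_sum _ _ _ _ _ r0) _.
  have y2n : pnorm (1 / 16) (2%:P * y) <= 9 / 128.
    by rewrite pnormCM ger0_norm //; lra.
  have := @pnorm_tail_le _ _ _ (2%:P * y) (fun k => k ^ 2 - 2)%N 0 L r0 y2n.
  move=> /(_ _)/(_ _)/(le_trans _) h.
  apply: (@le_trans _ _ (9 / 4 * \sum_(2 <= k < L)
    pnorm (1 / 16) ((2%:P * y) ^+ (k ^ 2 - 2)))).
    rewrite mulr_sumr !big_nat; apply: ler_sum => k /andP[k2 _].
    have -> : (2%:P * y) ^+ (k ^ 2 - 2) = (2 ^+ (k ^ 2 - 2))%:P * y ^+ (k ^ 2 - 2).
      by rewrite exprMn polyC_exp.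
    rewrite pnormCM ger0_norm ?exprn_ge0 //.
    apply: le_trans (pnormM _ _ _ _ r0) _; rewrite [leRHS]mulrA.
    rewrite ler_wpM2r ?pnorm_ge0 //.
    apply: le_trans (pnormM _ _ _ _ r0) _; rewrite pnormCM ger0_norm ?invr_ge0 //.
    have c1 : pnorm (1 / 16) ((k ^ 2)%:R - 'X : {poly R}) <= 4 * 2 ^+ (k ^ 2 - 2).
      apply: le_trans (pnormD _ _ _ _ r0) _.
      rewrite pnormN pnormX -polyC_natr pnormC ger0_norm //.
      have := sqrn_le_expn2 k k2; rewrite -(ler_nat R) natrM -natr1 [(2 ^ _)%:R]natrX.
      lra.
    have hs : 2^-1 * pnorm (1 / 16) s <= 9 / 16 by lra.
    apply: le_trans (ler_pM _ _ c1 hs) _; rewrite ?pnorm_ge0 ?mulr_ge0 ?invr_ge0 //.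
    lra.
  have : \sum_(2 <= k < L) pnorm (1 / 16) ((2%:P * y) ^+ (k ^ 2 - 2)) <= 2 * (9 / 128) ^+ 2.
    apply: h => //; first by lra.
    by move=> k k2; rewrite -mulnn; nia.
  lra.
have h : pnorm (1 / 16) (1 - S) <= 3 / 2.
  apply: le_trans (pnormD _ _ _ _ r0) _.
  by rewrite pnormN -polyC1 pnormC normr1; lra.
by apply: le_trans (ler_pM _ _ sn h) _; rewrite ?pnorm_ge0 //; lra.
Qed.

Lemma pnorm_saddle_t (R : realFieldType) N : pnorm (1 / 16) (saddle_t N) <= 2 :> R.
Proof.
elim: N => [|N IH]; first by rewrite /= pnorm0.
rewrite saddle_tS; apply: pnorm_saddle_step.
have r0 : 0 <= 1 / 16 :> R by lra.
apply: le_trans (pnormD _ _ _ _ r0) _; rewrite pnormXM -polyC1 pnormC normr1; lra.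
Qed.

Lemma pnorm_saddle_s (R : realFieldType) N : pnorm (1 / 16) (saddle_s N) <= 9 / 8 :> R.
Proof.
have r0 : 0 <= 1 / 16 :> R by lra.
have := pnorm_saddle_t R N => t2.
apply: le_trans (pnormD _ _ _ _ r0) _; rewrite pnormXM -polyC1 pnormC normr1; lra.
Qed.

Lemma pnorm_theta_v (R : realFieldType) N : pnorm (1 / 16) (theta_v N) <= 2 :> R.
Proof.
have r0 : 0 <= 1 / 16 :> R by lra.
have sn := pnorm_saddle_s R N; have yn := pnorm_half_Xs _ _ sn.
apply: le_trans (pnormM _ _ _ _ r0) _.
set S := \sum_(_ <= _ < _) _.
have SN : pnorm (1 / 16) S <= 1 / 2.
  apply: le_trans (pnorm_sum _ _ _ _ _ r0) _.
  apply: le_trans (@pnorm_tail_le _ _ _ _ (fun k => k ^ 2 - 1)%N 1 _ r0 yn _ _) _.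
  - lra.
  - by move=> k k2; rewrite -mulnn; nia.
  lra.
have h : pnorm (1 / 16) (1 + S) <= 3 / 2.
  apply: le_trans (pnormD _ _ _ _ r0) _.
  by rewrite -polyC1 pnormC normr1; lra.
by apply: le_trans (ler_pM _ _ sn h) _; rewrite ?pnorm_ge0 //; lra.
Qed.

Lemma pnorm_lnquot (R : realFieldType) N (P : {poly R}) :
  pnorm (1 / 16) P <= 2 -> pnorm (1 / 16) (lnquot N P) <= 4.
Proof.
move=> Pn; have r0 : 0 <= 1 / 16 :> R by lra.
have P0 := pnorm_ge0 _ _ P r0.
apply: le_trans (pnorm_sum _ _ _ _ _ r0) _.
apply: (@le_trans _ _ (\sum_(k < N) 2 * (1 / 8) ^+ k)).
  apply: ler_sum => k _; rewrite -mulrA pnormCM.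
  have -> : `|(-1) ^+ k / k.+1%:R| = `|k.+1%:R^-1| :> R.
    by rewrite normrM normrX normrN normr1 expr1n mul1r.
  apply: (@le_trans _ _ (pnorm (1 / 16) ('X^k * P ^+ k.+1))).
    rewrite ler_piMl ?pnorm_ge0 // normfV ger0_norm // invf_le1 ?ltr0n //.
    by rewrite ler1n.
  apply: le_trans (pnormM _ _ _ _ r0) _.
  have h1 : pnorm (1 / 16) 'X^k <= (1 / 16) ^+ k :> R.
    by apply: le_trans (pnorm_exp _ _ _ _ r0) _; rewrite pnormX.
  have h2 : pnorm (1 / 16) (P ^+ k.+1) <= 2 ^+ k.+1.
    by apply: le_trans (pnorm_exp _ _ _ _ r0) _; apply: lerXn2r; rewrite ?nnegrE.
  apply: le_trans (ler_pM _ _ h1 h2) _; rewrite ?pnorm_ge0 //.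
  rewrite exprS mulrCA -exprMn; have -> : 1 / 16 * 2 = 1 / 8 :> R by lra.
  by [].
rewrite -mulr_sumr.
(* The subtracted term makes the bound inductive. *)
suff : \sum_(k < N) (1 / 8) ^+ k <= 2 - 2 * (1 / 8) ^+ N :> R.
  have : 0 <= (1 / 8) ^+ N :> R by rewrite exprn_ge0 //; lra.
  lra.
elim: N => [|N IH]; first by rewrite big_ord0 expr0; lra.
rewrite big_ord_recr /= exprS.
have : 0 <= (1 / 8) ^+ N :> R by rewrite exprn_ge0 //; lra.
move: IH; move: (\sum_(_ < _) _) ((1 / 8) ^+ N) => u v; lra.
Qed.

Lemma pnorm_rate_poly (R : realFieldType) N : pnorm (1 / 16) (rate_poly N) <= 6 :> R.
Proof.
have r0 : 0 <= 1 / 16 :> R by lra.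
apply: le_trans (pnormD _ _ _ _ r0) _; rewrite pnormN -polyC1 pnormC normr1.
have h := pnormD _ (1 / 16) (lnquot N (theta_v N)) (- ('X * lnquot N (saddle_t N))) r0.
rewrite pnormN pnormXM in h.
have h1 := pnorm_lnquot _ N _ (pnorm_theta_v R N).
have h2 := pnorm_lnquot _ N _ (pnorm_saddle_t R N).
move: h h1 h2; move: (pnorm _ _) (pnorm _ _) (pnorm _ _) => *; lra.
Qed.

(** * Values of the recursion and the rate function *)

Lemma horner_saddle_step (R : fieldType) L (P : {poly R}) (x : R) :
  (saddle_step L P).[x] = P.[x] * (1 - \sum_(2 <= k < L)
    ((k ^ 2)%:R - x) * (2^-1 * P.[x]) * (2^-1 * x * P.[x]) ^+ (k ^ 2 - 2)).
Proof.
rewrite /saddle_step hornerM hornerD hornerN horner_sum -polyC1 hornerC.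
congr (_ * (_ - _)); apply: eq_bigr => k _.
by rewrite !hornerE -polyC_natr !hornerE.
Qed.

Lemma horner_saddle_s (R : fieldType) N (x : R) :
  (saddle_s N).[x] = 1 + x * (saddle_t N).[x].
Proof. by rewrite !hornerE. Qed.

Lemma horner_theta_v (R : fieldType) N (x : R) :
  (theta_v N).[x] = (saddle_s N).[x] *
  (1 + \sum_(2 <= k < N.+3) (2^-1 * x * (saddle_s N).[x]) ^+ (k ^ 2 - 1)).
Proof.
rewrite /theta_v; move: (saddle_s N) => s.
rewrite hornerM hornerD horner_sum -polyC1 hornerC.
by congr (_ * (_ + _)); apply: eq_bigr => k _; rewrite !hornerE.
Qed.

Lemma coord_gf_theta_v (R : numFieldType) N (x : R) :
  let q := x * (saddle_s N).[x] / 2 in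
  coord_gf N.+3 (1 + 2 * q) q = 1 + x * (theta_v N).[x].
Proof.
move=> q; rewrite horner_theta_v.
rewrite /coord_gf mulrDr mulr1 mulrDr !addrA; congr (_ + _ + _).
  by rewrite /q; field.
rewrite !mulr_sumr !big_nat; apply: eq_bigr => k /andP[k2 _].
have [m ->] : exists m, (k ^ 2 = m.+1)%N.
  by exists (k ^ 2).-1; rewrite prednK // expn_gt0 (ltn_trans _ k2).
rewrite subn1 /=; set s := (saddle_s N).[x].
have -> : 2^-1 * x * s = q by rewrite /q -/s; field.
by rewrite exprS /q -/s; move: (_ ^+ m) => z; field.
Qed.

(** The polynomial recursion is the saddle point equation: its residual at
    step [N] is, up to the total weight, the distance between [x] and the mean
    of a tilted coordinate. *)
Lemma saddle_residual (R : numFieldType) N (x : R) :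
  let q := x * (saddle_s N).[x] / 2 in
  x * coord_gf N.+3 (1 + 2 * q) q -
    (2 * q + \sum_(2 <= k < N.+3) (q ^+ (k ^ 2) * (k ^ 2)%:R) *+ 2) =
  x * ((saddle_s N.+1).[x] - (saddle_s N).[x]).
Proof.
move=> q; rewrite [(saddle_s N.+1).[x]]horner_saddle_s saddle_tS horner_saddle_step.
set s := (saddle_s N).[x].
have qE : 2^-1 * x * s = q by rewrite /q -/s; field.
have xs : x * s = 2 * q by rewrite /q -/s; field.
rewrite /coord_gf qE mulrBr [x * (1 + x * _)]mulrDr mulr1.
have -> : x * (x * (s * (1 - \sum_(2 <= k < N.+3)
   ((k ^ 2)%:R - x) * (2^-1 * s) * q ^+ (k ^ 2 - 2)))) =
   x * (x * s) - \sum_(2 <= k < N.+3) ((k ^ 2)%:R - x) * (q ^+ (k ^ 2) *+ 2).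
  rewrite mulrBr mulr1 mulrBr mulrBr; congr (_ - _).
  rewrite !mulr_sumr !big_nat; apply: eq_bigr => k /andP[k2 _].
  have [m ->] : exists m, (k ^ 2 = m.+2)%N.
    by exists (k ^ 2 - 2)%N; rewrite -mulnn; nia.
  rewrite subn2 /= [q ^+ m.+2]exprS [q ^+ m.+1]exprS; move: (q ^+ m) => z.
  by rewrite /q -/s; field.
have -> : \sum_(2 <= k < N.+3) ((k ^ 2)%:R - x) * (q ^+ (k ^ 2) *+ 2) =
  \sum_(2 <= k < N.+3) (q ^+ (k ^ 2) * (k ^ 2)%:R) *+ 2
  - x * \sum_(2 <= k < N.+3) q ^+ (k ^ 2) *+ 2.
  rewrite mulr_sumr -sumrB; apply: eq_bigr => k _.
  by move: (q ^+ (k ^ 2)) ((k ^ 2)%:R) => a b; ring.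
move: (\sum_(_ <= _ < _) _) (\sum_(_ <= _ < _) _) => S1 S0.
by rewrite !xs; ring.
Qed.

Lemma saddle_s_cauchy (R : realFieldType) N (x : R) : 0 <= x <= 1 / 32 ->
  `|(saddle_s N.+1).[x] - (saddle_s N).[x]| <= 4 * (1 / 2) ^+ N.
Proof.
move=> /andP[x0 x1]; rewrite !horner_saddle_s.
have -> : 1 + x * (saddle_t N.+1).[x] - (1 + x * (saddle_t N).[x]) =
  x * (saddle_t N.+1 - saddle_t N).[x] by rewrite hornerD hornerN; ring.
have r0 : 0 < 1 / 16 :> R by lra.
have xr : `|x| <= 1 / 16 by rewrite ger0_norm //; lra.
have st : eqmodX N (saddle_t N.+1 - saddle_t N) (0 : {poly R}).
  by rewrite /eqmodX subr0; exact: saddle_t_stable.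
have := pnorm_horner_eqmodX _ _ _ _ _ r0 xr st.
have h : pnorm (1 / 16) (saddle_t N.+1 - saddle_t N) <= 4 :> R.
  apply: le_trans (pnormD _ _ _ _ (ltW r0)) _; rewrite pnormN.
  have := pnorm_saddle_t R N; have := pnorm_saddle_t R N.+1; lra.
rewrite (ger0_norm x0) => h1.
have h2 : (x / (1 / 16)) ^+ N <= (1 / 2) ^+ N.
  by apply: lerXn2r; rewrite ?nnegrE ?divr_ge0 //; lra.
rewrite normrM (ger0_norm x0).
apply: (@le_trans _ _ `|(saddle_t N.+1 - saddle_t N).[x]|).
  by rewrite ler_piMl //; lra.
apply: le_trans h1 _; apply: ler_pM => //; first by rewrite pnorm_ge0 // ltW.
by rewrite exprn_ge0 // divr_ge0 // ltW.
Qed.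

Lemma lnquot_horner (R : realFieldType) N (P : {poly R}) (x : R) :
  x * (lnquot N P).[x] = (lnpoly R N).[x * P.[x]].
Proof.
rewrite /lnquot /lnpoly !horner_sum mulr_sumr; apply: eq_bigr => k _.
rewrite !hornerE exprMn [x ^+ k.+1]exprS /=; ring.
Qed.

Lemma ln_lnquot_le (R : realType) N (P : {poly R}) (x : R) : 0 <= x <= 1 / 32 ->
  pnorm (1 / 16) P <= 2 ->
  `|ln (1 + x * P.[x]) - x * (lnquot N P).[x]| <= 4 * x * (1 / 2) ^+ N.
Proof.
move=> /andP[x0 x1] Pn; rewrite lnquot_horner.
have xr : `|x| <= 1 / 16 by rewrite ger0_norm //; lra.
have Px := le_trans (pnorm_horner _ _ _ P xr) Pn.
have xP : `|x * P.[x]| <= 2 * x.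
  by rewrite normrM ger0_norm // mulrC ler_wpM2r.
apply: le_trans (ln1D_lnpoly_le _ _ _ _) _; first by apply: le_trans xP _; lra.
rewrite exprS.
have h : `|x * P.[x]| ^+ N <= (1 / 2) ^+ N.
  by apply: lerXn2r; rewrite ?nnegrE //; apply: le_trans xP _; lra.
have := ler_pM (normr_ge0 _) (exprn_ge0 _ (normr_ge0 _)) xP h.
move: (`|_| * _) ((1 / 2) ^+ N) => a b; lra.
Qed.

(** The function [n * rate (n / d)] is, up to [O(1)], the logarithm of the ratio
    between the number of points and [(2 e / alpha) ^ n / sqrt n]. *)
Definition rate {R : realType} (x : R) : R :=
  limn (pseries (stable_coef rate_poly) x).

(** Three errors, all geometric: the Taylor remainders of the two logarithms and
    the distance of [rate_poly N] to its limit. *)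
Lemma rate_approx (R : realType) N (x : R) : 0 < x <= 1 / 32 ->
  `|ln (1 + x * (theta_v N).[x]) / x - ln (saddle_s N).[x] - 1 - rate x| <=
  26 * (1 / 2) ^+ N.
Proof.
move=> /andP[x0 x1]; have xx : 0 <= x <= 1 / 32 by rewrite ltW.
have h1 := ln_lnquot_le _ N _ _ xx (pnorm_theta_v R N).
have h2 := ln_lnquot_le _ N _ _ xx (pnorm_saddle_t R N).
have r0 : 0 < 1 / 16 :> R by lra.
have xr : `|x| <= 1 / 16 by rewrite gtr0_norm //; lra.
have h3 := pseries_stable_coef_approx _ _ _ _ _ N r0 xr (pnorm_rate_poly R)
  (rate_poly_stable R).
rewrite -/(rate x) in h3; rewrite -horner_saddle_s in h2.
have e0 : 0 <= (1 / 2) ^+ N :> R by rewrite exprn_ge0 //; lra.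
have h4 : (`|x| / (1 / 16)) ^+ N <= (1 / 2) ^+ N.
  by rewrite gtr0_norm //; apply: lerXn2r; rewrite ?nnegrE ?divr_ge0 ?(ltW x0) //; lra.
have {}h1 : `|ln (1 + x * (theta_v N).[x]) / x - (lnquot N (theta_v N)).[x]| <=
    4 * (1 / 2) ^+ N.
  rewrite -(ler_pM2l x0) -{1}(gtr0_norm x0) -normrM mulrBr mulrC.
  by rewrite divfK ?gt_eqF //; apply: le_trans h1 _; lra.
have {}h2 : `|ln (saddle_s N).[x] - x * (lnquot N (saddle_t N)).[x]| <= 4 * (1 / 2) ^+ N.
  apply: le_trans h2 _; rewrite ler_wpM2r //; lra.
have rE : (rate_poly N).[x] =
    (lnquot N (theta_v N)).[x] - x * (lnquot N (saddle_t N)).[x] - 1.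
  by rewrite /rate_poly !hornerE.
rewrite rE in h3.
set a := ln _ / x in h1 *; set b := ln _ in h2 *.
set c := (lnquot _ _).[x] in h1 h3; set d := x * _ in h2 h3.
set e := (1 / 2) ^+ N in e0 h1 h2 h4 *; set w := (_ / _) ^+ N in h3 h4.
move: (rate x) a b c d e w e0 h1 h2 h3 h4; clear => g a b c d e w e0.
rewrite !ler_norml => /andP[? ?] /andP[? ?] /andP[? ?] we.
by apply/andP; split; lra.
Qed.

(** * The first coefficients of the rate function *)

Lemma eqmodX_ex (R : fieldType) N (P Q : {poly R}) :
  eqmodX N P Q -> exists A, P = Q + 'X^N * A.
Proof. by move=> /dvdpP[A e]; exists A; rewrite mulrC -e; ring. Qed.

Lemma lnquot4 (R : numFieldType) (P : {poly R}) :
  lnquot 4 P = P - (2^-1)%:P * 'X * P ^+ 2 + (3^-1)%:P * 'X ^+ 2 * P ^+ 3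
    - (4^-1)%:P * 'X ^+ 3 * P ^+ 4.
Proof.
rewrite /lnquot !big_ord_recr big_ord0 /= add0r !exprS !expr0 !mulr1 divr1 mul1r.
by rewrite !mulN1r opprK !mulNr !mul1r !polyCN; ring.
Qed.

(** Only the term of index 2 matters modulo low powers of [X]. *)
Lemma sum_from3_ex (R : fieldType) N L (F : nat -> {poly R}) :
  (2 < L)%N -> (forall k, (3 <= k)%N -> eqmodX N (F k) 0) ->
  exists B, \sum_(2 <= k < L) F k = F 2%N + 'X^N * B.
Proof.
move=> L2 F0; apply: eqmodX_ex; rewrite big_ltn // -[X in eqmodX _ _ X]addr0.
apply: eqmodXD; first exact: eqmodX_refl.
rewrite big_nat; elim/big_rec: _ => [|k P /andP[k3 _] P0]; first exact: eqmodX_refl.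
by rewrite -[0]addr0; apply: eqmodXD => //; exact: F0.
Qed.

(** The relation between consecutive iterates is a fixed point equation modulo
    [X ^ 3]; substituting it into itself yields one coefficient at a time. *)
Lemma saddle_t_expansion (R : numFieldType) : exists a3 : {poly R},
  saddle_t 4 = 1 + 'X + (2^-1)%:P * 'X ^+ 2 + 'X ^+ 3 * a3.
Proof.
set t : {poly R} := saddle_t 4; set h : {poly R} := (2^-1)%:P.
have h2 : h + h = 1 by rewrite -polyCD -[RHS]polyC1; congr polyC; field.
have [A] := eqmodX_ex _ _ _ _ (saddle_t_stable R 4).
rewrite saddle_tS -/t /saddle_step -/h.
have [|k k3|B ->] := @sum_from3_ex R 3 7 (fun k => ((k ^ 2)%:R - 'X) *
  (h * saddle_s 4) * (h * 'X * saddle_s 4) ^+ (k ^ 2 - 2)) => //.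
  rewrite [h * 'X * _]mulrAC exprMn mulrA -[_ * 'X^_]mulr1.
  by apply: eqmodX0; nia.
rewrite (_ : (2 ^ 2 - 2 = 2)%N) // (_ : (2 ^ 2)%:R = 4) //.
have -> : saddle_s 4 = 1 + 'X * t by [].
set s := 1 + 'X * t => e.
pose e4 := 4 * t + 6 * 'X * t ^+ 2 + 4 * 'X ^+ 2 * t ^+ 3 + 'X ^+ 3 * t ^+ 4.
pose c2 := - h * e4 + h ^+ 3 * s ^+ 4 - s * B - 'X * A.
pose c1 := - h + 'X * c2.
pose a1 := t + 'X * c1.
have h3 : 4 * h ^+ 3 = h.
  have -> : 4 * h ^+ 3 = (h + h) ^+ 2 * h by ring.
  by rewrite h2 expr1n mul1r.
(* The next coefficients come from [t = 1 + X a1] and [a1 = t + X c1]. *)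
have t1 : t = 1 + 'X * a1.
  have -> : t = s * (1 - ((4 - 'X) * (h * s) * (h * 'X * s) ^+ 2 + 'X ^+ 3 * B))
     - 'X ^+ 4 * A by rewrite e; ring.
  rewrite /a1 /c1 /c2.
  have -> : - h + 'X * (- h * e4 + h ^+ 3 * s ^+ 4 - s * B - 'X * A) =
    - (4 * h ^+ 3) - 'X * (4 * h ^+ 3) * e4 + 'X * (h ^+ 3 * s ^+ 4 - s * B - 'X * A).
    by rewrite h3; ring.
  rewrite /e4 /s; ring.
pose a2 := a1 + c1.
have a12 : a1 = 1 + 'X * a2 by rewrite {1}/a1 {1}t1 /a2; ring.
exists (a2 + c2).
rewrite {1}t1 {1}a12 /a2 {1}a12 /c1.
have -> : 1 + 'X * (1 + 'X * (1 + 'X * a2 + (- h + 'X * c2))) =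
  1 + 'X + (1 - h) * 'X ^+ 2 + 'X ^+ 3 * (a2 + c2) by ring.
by have -> : 1 - h = h by rewrite -h2 addrK.
Qed.

Lemma theta_v_expansion (R : numFieldType) : exists V : {poly R},
  theta_v 4 = 1 + 'X + 'X ^+ 2 + ((2^-1)%:P + (2^-1)%:P ^+ 3) * 'X ^+ 3
    + 'X ^+ 4 * V.
Proof.
have [a3 te] := saddle_t_expansion R; set h : {poly R} := (2^-1)%:P in te *.
rewrite /theta_v.
have [|k k3|C ->] := @sum_from3_ex R 4 7
   (fun k => (h * 'X * saddle_s 4) ^+ (k ^ 2 - 1)) => //.
  rewrite mulrAC exprMn -[_ * 'X^_]mulr1.
  by apply: eqmodX0; nia.
rewrite (_ : (2 ^ 2 - 1 = 3)%N) //.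
have -> : saddle_s 4 = 1 + 'X * saddle_t 4 by [].
set t := saddle_t 4 in te *; set s := 1 + 'X * t.
pose e4 := 4 * t + 6 * 'X * t ^+ 2 + 4 * 'X ^+ 2 * t ^+ 3 + 'X ^+ 3 * t ^+ 4.
exists (a3 + h ^+ 3 * e4 + s * C).
have -> : s * (1 + ((h * 'X * s) ^+ 3 + 'X ^+ 4 * C)) =
  s + h ^+ 3 * 'X ^+ 3 * s ^+ 4 + 'X ^+ 4 * (s * C) by ring.
have -> : s ^+ 4 = 1 + 'X * e4 by rewrite /e4 /s; ring.
rewrite {1}/s te; ring.
Qed.

Lemma rate_poly_expansion (R : numFieldType) : exists E : {poly R},
  rate_poly 4 = (- (1 / 2))%:P * 'X + (- (1 / 6))%:P * 'X ^+ 2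
    + (1 / 24)%:P * 'X ^+ 3 + 'X ^+ 4 * E.
Proof.
have [T te] := saddle_t_expansion R; have [V ve] := theta_v_expansion R.
rewrite /rate_poly !lnquot4.
set h : {poly R} := (2^-1)%:P in te ve *; set h3 : {poly R} := (3^-1)%:P.
set h4 : {poly R} := (4^-1)%:P.
have -> : (- (1 / 2))%:P = - h :> {poly R}.
  by rewrite -polyCN; congr polyC; field.
have -> : (- (1 / 6))%:P = h3 - h :> {poly R}.
  by rewrite -polyCB; congr polyC; field.
have -> : (1 / 24)%:P = h ^+ 3 - h + h3 + h3 - h4 :> {poly R}.
  by rewrite -polyC_exp -!polyCN -!polyCD; congr polyC; field.
set c := h + h ^+ 3 in ve.
pose w := c + 'X * V; pose u := 1 + 'X * w; pose z := 1 + 'X * u.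
have v3 : theta_v 4 = 1 + 'X + 'X ^+ 2 + 'X ^+ 3 * w by rewrite ve /w; ring.
have v2 : theta_v 4 = 1 + 'X + 'X ^+ 2 * u by rewrite v3 /u; ring.
have v1 : theta_v 4 = 1 + 'X * z by rewrite v2 /z; ring.
set v := theta_v 4 in ve v1 v2 v3 *; set t := saddle_t 4 in te *.
(* [r2], [r3] and [r4] are the remainders of the powers of [theta_v 4]
   beyond the order that contributes. *)
pose r2 := 2 + 'X + 2 * (1 + 'X + 'X ^+ 2) * w + 'X ^+ 3 * w ^+ 2.
pose r3 := 3 + 'X + 3 * (1 + 'X) ^+ 2 * u + 3 * (1 + 'X) * 'X ^+ 2 * u ^+ 2
  + 'X ^+ 4 * u ^+ 3.
pose r4 := 4 * z + 6 * 'X * z ^+ 2 + 4 * 'X ^+ 2 * z ^+ 3 + 'X ^+ 3 * z ^+ 4.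
have -> : v ^+ 2 = 1 + 2 * 'X + 3 * 'X ^+ 2 + 'X ^+ 3 * r2.
  by rewrite v3 /r2; move: (w) => a; ring.
have -> : v ^+ 3 = 1 + 3 * 'X + 'X ^+ 2 * r3.
  by rewrite v2 /r3; move: (u) => a; ring.
have -> : v ^+ 4 = 1 + 'X * r4.
  by rewrite v1 /r4; move: (z) => a; ring.
rewrite ve; move: (r2) (r3) (r4) => {}r2 {}r3 {}r4.
pose y := h + 'X * T; pose x := 1 + 'X * y.
have t2 : t = 1 + 'X + 'X ^+ 2 * y by rewrite te /y; ring.
have t1 : t = 1 + 'X * x by rewrite t2 /x; ring.
pose p2 := 1 + 2 * (1 + 'X) * y + 'X ^+ 2 * y ^+ 2.
pose p3 := 3 * x + 3 * 'X * x ^+ 2 + 'X ^+ 2 * x ^+ 3.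
have -> : t ^+ 2 = 1 + 2 * 'X + 'X ^+ 2 * p2 by rewrite t2 /p2; move: (y) => a; ring.
have -> : t ^+ 3 = 1 + 'X * p3 by rewrite t1 /p3; move: (x) => a; ring.
move: (t ^+ 4) => t4; rewrite te; move: (p2) (p3) => {}p2 {}p3.
exists (V - h * r2 + h3 * r3 - h4 * r4 - (T - h * p2 + h3 * p3 - h4 * t4)).
rewrite /c; ring.
Qed.

Lemma rate_coefs (R : numFieldType) :
  [/\ stable_coef rate_poly 0 = 0 :> R,
      stable_coef rate_poly 1 = - (1 / 2) :> R,
      stable_coef rate_poly 2 = - (1 / 6) :> R &
      stable_coef rate_poly 3 = 1 / 24 :> R].
Proof.
have [E e] := rate_poly_expansion R.
have cE k : (k < 4)%N -> stable_coef rate_poly k =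
    (rate_poly 4 : {poly R})`_k.
  by apply: stable_coefE; exact: rate_poly_stable.
by split; rewrite cE // e !coefD !coefCM coefX !coefXn ['X^4 * _]mulrC coefMXn /=
  ?mulr0 ?mulr1 ?addr0 ?add0r.
Qed.

(** * The asymptotic formula *)

Lemma expR1_le4 (R : realType) : expR 1 <= 4 :> R.
Proof.
have -> : expR 1 = expR (1 / 2) ^+ 2 :> R by rewrite -expRM_natl; congr expR; field.
have -> : 4 = 2 ^+ 2 :> R by ring.
by apply: lerXn2r; rewrite ?nnegrE ?expR_ge0 ?expR_half_le2.
Qed.

Lemma mul_half_exp_le (R : realFieldType) n :
  n%:R * (1 / 2) ^+ (n + 5) <= 1 / 32 :> R.
Proof.
have -> : n%:R * (1 / 2) ^+ (n + 5) = n%:R / 2 ^+ n * (1 / 2) ^+ 5 :> R.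
  by rewrite exprD mulrA [(1 / 2) ^+ n]expr_div_n expr1n [1 / 2 ^+ n]div1r.
have h : n%:R / 2 ^+ n <= 1 :> R.
  by rewrite ler_pdivrMr ?exprn_gt0 // mul1r -natrX ler_nat ltnW // ltn_expl.
have -> : (1 / 2) ^+ 5 = 1 / 32 :> R by field.
by rewrite ler_piMl //; lra.
Qed.

(** At the stage [N = n + 5] of the recursion, the errors of [saddle_s_cauchy] and
    [rate_approx], once multiplied by [n], are at most [1 / 8] and 1.  The first
    makes the saddle point estimate available; the second costs a factor [exp 1]
    in each bound. *)
Lemma card_sphere_rate (R : realType) n d :
  let x : R := n%:R / d%:R in
  let main := 2 ^+ n * expR 1 ^+ n * x ^- n * expR (n%:R * rate x) in
  (0 < n)%N -> (100 * n <= d)%N ->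
  (card_sphere n d)%:R * Num.sqrt n%:R <= 108 * main /\
  main <= 768 * ((card_sphere n d)%:R * Num.sqrt n%:R).
Proof.
move=> x main n0 nd; have nL : (n < (n + 5).+3)%N by lia.
have n0' : 0 < n%:R :> R by rewrite ltr0n.
have d100 : 100 * n%:R <= d%:R :> R by rewrite -natrM ler_nat.
have d0 : 0 < d%:R :> R by lra.
have x0 : 0 < x by rewrite divr_gt0.
have x1 : x <= 1 / 100 by rewrite ler_pdivrMr //; lra.
have dx : d%:R * x = n%:R by rewrite mulrC divfK // gt_eqF.
have xx : 0 < x <= 1 / 32 by rewrite x0 /=; lra.
have xx' : 0 <= x <= 1 / 32 by rewrite (ltW x0) /=; lra.
have half := mul_half_exp_le R n; pose N := (n + 5)%N; rewrite -/N in half nL.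
have cau := saddle_s_cauchy R N x xx'.
have app := rate_approx R N x xx.
pose s := (saddle_s N).[x]; rewrite -/s in app.
have sE : `|s - 1| <= 1 / 50.
  rewrite /s horner_saddle_s addrAC subrr add0r normrM gtr0_norm //.
  have xr : `|x| <= 1 / 16 by rewrite gtr0_norm //; lra.
  have tn := le_trans (pnorm_horner _ _ _ _ xr) (pnorm_saddle_t R N).
  by have := ler_wpM2l (ltW x0) tn; lra.
have /andP[s1 s2] : 98 / 100 <= s <= 102 / 100.
  by move: sE; rewrite ler_norml => /andP[? ?]; apply/andP; split; lra.
have s0 : 0 < s by lra.
pose q := x * s / 2; have q0 : 0 < q by rewrite /q !mulr_gt0 // invr_gt0.
have qd : 7 * n%:R <= 16 * (d%:R * q) <= 9 * n%:R.
  have -> : d%:R * q = n%:R * s / 2 by rewrite -dx /q; ring.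
  have := ler_wpM2l (ltW n0') s1; have := ler_wpM2l (ltW n0') s2.
  by move=> *; apply/andP; split; lra.
pose Z := coord_gf N.+3 (1 + 2 * q) q.
have ZE : Z = 1 + x * (theta_v N).[x] := coord_gf_theta_v _ _ _.
have Z1 : 1 <= Z.
  have : 0 <= \sum_(2 <= k < N.+3) q ^+ (k ^ 2) *+ 2.
    by apply: sumr_ge0 => k _; rewrite mulrn_wge0 // exprn_ge0 // ltW.
  by rewrite /Z /coord_gf; move: q0; clear; lra.
have Z0 : 0 < Z by lra.
rewrite -ZE in app.
have [] := @card_sphere_saddle R N.+3 n d q isT nL n0 nd qd.
  rewrite -/Z; set S1 := \sum_(_ <= _ < _) _.
  have res : x * Z - (2 * q + S1) = x * ((saddle_s N.+1).[x] - s) := saddle_residual _ _ _.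
  have -> : n%:R - d%:R * ((2 * q + S1) / Z) =
      n%:R * ((saddle_s N.+1).[x] - s) / Z.
    rewrite -dx -[d%:R * x * _]mulrA -res; field; exact: lt0r_neq0.
  rewrite normrM normfV (gtr0_norm Z0) ler_pdivrMr // normrM (gtr0_norm n0').
  apply: le_trans (ler_wpM2l (ltW n0') cau) _.
  by rewrite mulrCA; move: half Z1; lra.
rewrite -/Z; pose psi := ln Z / x - ln s - 1.
have ZdE : Z ^+ d = q ^+ n * (2 ^+ n * expR 1 ^+ n * x ^- n * expR (n%:R * psi)).
  have -> : q ^+ n * (2 ^+ n * expR 1 ^+ n * x ^- n * expR (n%:R * psi)) =
      (q * 2 * expR 1 / x) ^+ n * expR (n%:R * psi).
    by move: (q) (expR 1) (x) => a e y; rewrite !exprMn exprVn !mulrA.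
  have -> : q * 2 * expR 1 / x = expR (ln s + 1).
    by rewrite expRD lnK ?posrE // /q; field; exact: lt0r_neq0.
  rewrite -expRM_natl -expRD -mulrDr -[LHS](@lnK R) ?posrE ?exprn_gt0 //.
  rewrite lnXn // -mulr_natl -dx /psi; congr expR.
  by field; exact: lt0r_neq0.
have M0 : 0 < 2 ^+ n * expR 1 ^+ n * x ^- n.
  by rewrite !mulr_gt0 ?invr_gt0 ?exprn_gt0 ?expR_gt0.
have qn0 : 0 < q ^+ n by rewrite exprn_gt0.
have [p1 p2] : n%:R * psi <= 1 + n%:R * rate x /\ n%:R * rate x <= 1 + n%:R * psi.
  have : n%:R * `|psi - rate x| <= 1.
    apply: le_trans (ler_wpM2l (ltW n0') app) _; rewrite mulrCA.
    by move: half; lra.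
  rewrite -{1}(gtr0_norm n0') -normrM mulrBr ler_norml => /andP[? ?].
  by split; lra.
have e1 : expR (n%:R * psi) <= 4 * expR (n%:R * rate x).
  apply: (@le_trans _ _ (expR (1 + n%:R * rate x))); first by rewrite ler_expR.
  by rewrite expRD ler_wpM2r ?expR_ge0 ?expR1_le4.
have e2 : expR (n%:R * rate x) <= 4 * expR (n%:R * psi).
  apply: (@le_trans _ _ (expR (1 + n%:R * psi))); first by rewrite ler_expR.
  by rewrite expRD ler_wpM2r ?expR_ge0 ?expR1_le4.
rewrite ZdE /main; move: (2 ^+ n * _ * _) M0 => M M0.
move: (expR (n%:R * psi)) (expR (n%:R * rate x)) e1 e2 => u v e1 e2.
set S := (card_sphere n d)%:R; set r := Num.sqrt n%:R.
have -> : S * q ^+ n * r = q ^+ n * (S * r) by ring.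
have -> : 27 * (q ^+ n * (M * u)) = q ^+ n * (27 * (M * u)) by ring.
have -> : 192 * (q ^+ n * (S * r)) = q ^+ n * (192 * (S * r)) by ring.
rewrite !ler_pM2l // => h1 h2.
have := ler_wpM2l (ltW M0) e1; have := ler_wpM2l (ltW M0) e2.
by move=> *; split; lra.
Qed.

Theorem theorem1p3 (R : realType) :
  exists (b : nat -> R) (c C1 C2 : R),
    (power_series_coeffs b /\
     b 1%N = - (1 / 2%:R) /\ b 2%N = - (1 / 6%:R) /\ b 3%N = 1 / 24%:R) /\
    (0 < c < 1 /\ 0 < C1 /\ 0 < C2) /\
    forall K : nat, (0 < K)%N ->
      exists (CK : R) (E : nat -> nat -> R),
        forall n d : nat, (0 < n)%N -> (0 < d)%N -> n%:R <= c * d%:R ->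
          let alpha : R := n%:R / d%:R in
          let middle : R :=
            C1 * 2%:R ^+ n * expR 1 ^+ n * alpha ^- n * (1 / Num.sqrt n%:R) *
            expR (\sum_(1 <= k < K.+1) b k * n%:R * alpha ^+ k + E n d) in
          `|E n d| <= CK * (n%:R * alpha ^+ K.+1) /\
          (card_sphere n d)%:R <= (card_ball n d)%:R :> R /\
          (card_ball n d)%:R <= middle /\
          middle <= C2 * (card_sphere n d)%:R.
Proof.
pose b : nat -> R := stable_coef rate_poly.
have [b0 b1 b2 b3] := rate_coefs R.
have r0 : 0 < 1 / 16 :> R by lra.
(* The factor 2 between 108 and 216 comes from the ball,
   and [768] from the lower bound for the sphere. *)
exists b, (1 / 100), 216, (216 * 768); split.
  split=> //; exists (1 / 16) => // x xr.
  exact: cvg_pseries_stable_coef r0 (ltW xr) (pnorm_rate_poly R) (rate_poly_stable R).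
split; first by repeat split; lra.
move=> K _; exists (6 * 16 ^+ K.+1).
exists (fun n d => n%:R * (rate (n%:R / d%:R) -
  \sum_(1 <= k < K.+1) b k * (n%:R / d%:R) ^+ k)).
move=> n d n0 d0 nd alpha middle.
have n0' : 0 < n%:R :> R by rewrite ltr0n.
have d0' : 0 < d%:R :> R by rewrite ltr0n.
have a0 : 0 < alpha by rewrite divr_gt0.
have nd100 : (100 * n <= d)%N by rewrite -(ler_nat R) natrM; lra.
have a16 : `|alpha| <= 1 / 16.
  by rewrite gtr0_norm // ler_pdivrMr //; lra.
have [su sl] := card_sphere_rate R n d n0 nd100.
rewrite -/alpha in su sl *.
split.
  have := pseries_stable_coef_tail _ _ _ _ _ K.+1 r0 a16 (pnorm_rate_poly R)
    (rate_poly_stable R).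
  (* The series has no constant term, so the sum may start at 1. *)
  rewrite -/(rate alpha) big_ltn // b0 mul0r add0r => h.
  rewrite /= -/alpha normrM (gtr0_norm n0').
  apply: le_trans (ler_wpM2l (ltW n0') h) _.
  rewrite (gtr0_norm a0); move: (alpha) => a.
  have -> : a / (1 / 16) = a * 16 by field.
  rewrite exprMn.
  by rewrite le_eqVlt; apply/orP; left; apply/eqP; ring.
split; first by rewrite ler_nat card_sphere_le_ball.
have s0 : 0 < Num.sqrt n%:R :> R by rewrite sqrtr_gt0.
have ball : (card_ball n d)%:R <= 2 * (card_sphere n d)%:R :> R.
  by rewrite -natrM ler_nat card_ball_le_sphere //; lia.
have -> : middle = 216 * (2 ^+ n * expR 1 ^+ n * alpha ^- n *
    expR (n%:R * rate alpha)) / Num.sqrt n%:R.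
  rewrite /middle.
  have -> : \sum_(1 <= k < K.+1) b k * n%:R * alpha ^+ k =
      n%:R * \sum_(1 <= k < K.+1) b k * alpha ^+ k.
    by rewrite mulr_sumr; apply: eq_bigr => k _; rewrite mulrCA mulrA.
  rewrite -mulrDr addrC subrK; ring.
move: su sl; move: (2 ^+ n * _ * _ * _) => M su sl.
rewrite ler_pdivlMr // ler_pdivrMr //; split.
  apply: le_trans (ler_wpM2r (ltW s0) ball) _; lra.
lra.
Qed.
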